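(* For $|q|<1$, with all sums over $i,j,k\in\mathbb{Z}_{\ge0}$, \begin{align*} \sum_{i,j,k\geq 0}\frac{q^{i^2+\frac{1}{2}j^2+\frac{1}{2}k^2+ij-ik-\frac{1}{2}j-\frac{1}{2}k}}{(q;q)_i(q;q)_j(q;q)_k}&=6\frac{J_2^3}{J_1^3}, \\ \sum_{i,j,k\geq 0} \frac{q^{2i^2+j^2+k^2+2ij-2ik+k}}{(q^2;q^2)_i(q^2;q^2)_j(q^2;q^2)_k}&=\frac{J_3^2J_4}{J_1J_2J_6}, \\ \sum_{i,j,k\geq 0}\frac{q^{2i^2+j^2+k^2+2ij-2ik+j}}{(q^2;q^2)_i(q^2;q^2)_j(q^2;q^2)_k}&=\frac{J_2^2J_3^2}{J_1^2J_4J_6}, \\ \sum_{i,j,k\geq 0}\frac{q^{2i^2+j^2+k^2+2ij-2ik+2i+j}}{(q^2;q^2)_i(q^2;q^2)_j(q^2;q^2)_k}&=\frac{J_2J_6^2}{J_1J_3J_4}, \\ \sum_{i,j,k\geq 0} \frac{q^{2i^2+j^2+k^2+2ij-2ik+2i+2j-k}}{(q^2;q^2)_i(q^2;q^2)_j(q^2;q^2)_k}&=2\frac{J_4J_6^2}{J_2^2J_3}. \end{align*}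
   Context: For $|q|<1$: $(a;q)_n=\prod_{k=0}^{n-1}(1-aq^k)$ ($(a;q)_0=1$), $(a;q)_\infty=\prod_{k\ge0}(1-aq^k)$, and $J_m:=(q^m;q^m)_\infty$. Half-integer powers $q^{x/2}$ are defined via a fixed branch $q^{1/2}$ (e.g. $0<q<1$ with positive root). *)

(* Defs.v *)
From HB Require Import structures.
From mathcomp Require Import all_boot all_order all_algebra.
From mathcomp Require Import all_classical all_reals all_analysis.
From mathcomp Require Import complex.
Set Implicit Arguments. Unset Strict Implicit. Unset Printing Implicit Defensive.
Import Order.TTheory GRing.Theory Num.Theory.
Import numFieldNormedType.Exports.
Local Open Scope ring_scope.
Local Open Scope classical_set_scope.

(* Equip the complex numbers R[i] with the norm topology (|z| = complex
   modulus), as for any numFieldType (numFieldNormedType pattern). *)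
Section ComplexTopology.
Variable R : realType.
HB.instance Definition _ := NormedModule.copy R[i] (R[i]^o).
End ComplexTopology.

Definition qpoch {C : comNzRingType} (a q : C) (n : nat) : C :=
  \prod_(k < n) (1 - a * q ^+ k).

Definition qpoch_inf {R : realType} (a q : R[i]) : R[i] :=
  lim ((fun n => (qpoch a q n : R[i])) @ \oo).

Definition J {R : realType} (q : R[i]) (m : nat) : R[i] :=
  qpoch_inf (q ^+ m) (q ^+ m).

(* The triple sum over i,j,k >= 0 is taken as the limit of the partial sums
   over the cubes [0,N)^3 (the series in question are absolutely convergent). *)
Definition cube_sum {C : zmodType} (F : nat -> nat -> nat -> C) (N : nat) : C :=
  \sum_(i < N) \sum_(j < N) \sum_(k < N) F i j k.

(* Main.v *)
(* Summing over j and k with Euler's identity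
   sum_k x^k q^C(k,2) / (q;q)_k = (-x;q)_oo turns each triple sum into a product
   times a single sum over i. For the first identity the single sum is again of
   Euler type. The other four (in base p = q^2) have the shape
     sum_i (rho;p)_i (-b)^i p^C(i,2) / ((p;p)_i (c;p)_i),
   with rho b = a p and a = 1 or a = p: applying Bailey's lemma twice to the
   unit Bailey pair relative to a evaluates them by one of the theta series
     sum_{k in Z} (-1)^k q^(3 k^2),   sum_{k in Z} (-1)^k q^(3 k^2 + 2 k),
   which are products by the Jacobi triple product in base q^6. Each ingredient
   is an identity between finite sums, and Tannery's theorem gives the limits.
   The case q = 0, where negative powers of q are unavailable, is a finite
   count. *)

Require Import Defs.
From HB Require Import structures.
From mathcomp Require Import all_boot all_order all_algebra.
From mathcomp Require Import all_classical all_reals all_analysis.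
From mathcomp Require Import complex.
From mathcomp Require Import ring lra zify.
Import Order.TTheory GRing.Theory Num.Theory.
Import numFieldNormedType.Exports.
Local Open Scope ring_scope.
Local Open Scope classical_set_scope.
Set Implicit Arguments. Unset Strict Implicit.

(** * Bailey pairs *)

Lemma bin2_sqr n : (2 * 'C(n, 2) + n = n * n)%N.
Proof. by elim: n => // n IH; rewrite binS bin1; nia. Qed.

Lemma sqrn_bin2 n : (n ^ 2 = 'C(n, 2) + 'C(n.+1, 2))%N.
Proof. by have := bin2_sqr n; rewrite binS bin1; nia. Qed.

Section QSeries.
Variables (F : fieldType) (q : F).
Hypothesis q_neq0 : q != 0.
Hypothesis qq_neq0 : forall n, qpoch q q n != 0.

Lemma qpoch0 (a : F) : qpoch a q 0 = 1.
Proof. by rewrite /qpoch big_ord0. Qed.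

Lemma qpochS (a : F) n : qpoch a q n.+1 = qpoch a q n * (1 - a * q ^+ n).
Proof. by rewrite /qpoch big_ord_recr. Qed.

Lemma qpochSl (a : F) n : qpoch a q n.+1 = (1 - a) * qpoch (a * q) q n.
Proof.
rewrite /qpoch big_ord_recl expr0 mulr1; congr (_ * _).
by apply: eq_bigr => i _; rewrite /= exprS mulrA.
Qed.

Lemma qpochD (a : F) m n :
  qpoch a q (m + n) = qpoch a q m * qpoch (a * q ^+ m) q n.
Proof.
elim: n => [|n IH]; first by rewrite addn0 qpoch0 mulr1.
by rewrite addnS !qpochS IH exprD !mulrA.
Qed.

Lemma expr_bin2S n : q ^+ 'C(n.+1, 2) = q ^+ 'C(n, 2) * q ^+ n.
Proof. by rewrite binS bin1 exprD. Qed.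

Lemma subq_neq0 n : 1 - q * q ^+ n != 0.
Proof. by have := qq_neq0 n.+1; rewrite qpochS mulf_eq0 negb_or => /andP[]. Qed.

(* Pascal's rule gives P_(M+1)(A, b) = (1 - b) P_M(A, b q) for the
   left-hand side normalized by (q; q)_M. *)
Lemma q_chu_vandermonde (A b : F) M :
  \sum_(m < M.+1) qpoch A q m * (- b) ^+ m * q ^+ 'C(m, 2)
     * qpoch (A * b * q ^+ m) q (M - m) / (qpoch q q m * qpoch q q (M - m))
  = qpoch b q M / qpoch q q M.
Proof.
elim: M b => [|M IH] b.
  by rewrite big_ord1 /= !qpoch0 expr0 !mulr1.
pose T m := qpoch A q m * (- b) ^+ m * q ^+ 'C(m, 2)
  * qpoch (A * b * q ^+ m) q (M.+1 - m) / (qpoch q q m * qpoch q q (M.+1 - m)).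
have Mq := subq_neq0 M.
apply: (mulfI Mq); rewrite mulr_sumr.
rewrite (eq_bigr (fun m : 'I_M.+2 => q ^+ m * (1 - q ^+ (M.+1 - m)) * T m
   + (1 - q ^+ m) * T m)); last first.
  move=> m _; rewrite -/(T m) -mulrDl; congr (_ * _).
  have {1}-> : q * q ^+ M = q ^+ m * q ^+ (M.+1 - m).
    by rewrite -exprS -exprD subnKC // -ltnS.
  by ring.
rewrite big_split big_ord_recr [\sum_(i < _) (1 - _) * _]big_ord_recl /=.
rewrite subnn expr0 subrr mulr0 !mul0r addr0 add0r -big_split /= qpochSl.
transitivity ((1 - b) * (qpoch (b * q) q M / qpoch q q M)); last first.
  by rewrite (qpochS q M); field; rewrite qq_neq0 Mq.
rewrite -IH mulr_sumr; apply: eq_bigr => m _.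
have lemM : (m <= M)%N by rewrite -ltnS.
rewrite /T /bump /= add1n subSS subSn // expr_bin2S.
rewrite (qpochSl (A * b * q ^+ m)) (qpochS A) !(qpochS q) -!exprS.
have -> : A * b * q ^+ m.+1 = A * (b * q) * q ^+ m by rewrite exprS; ring.
have -> : A * b * q ^+ m * q = A * (b * q) * q ^+ m by ring.
have -> : (- (b * q)) ^+ m = (- b) ^+ m * q ^+ m.
  by rewrite -exprMn mulNr.
have h1 := subq_neq0 m; have h2 := subq_neq0 (M - m).
rewrite -exprS in h1; rewrite -exprS in h2.
rewrite (exprS (- b)); field.
by rewrite !qq_neq0 h1 h2.
Qed.

Lemma q_binomial (x : F) M :
  \sum_(m < M.+1) (- x) ^+ m * q ^+ 'C(m, 2)
     / (qpoch q q m * qpoch q q (M - m))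
  = qpoch x q M / qpoch q q M.
Proof.
rewrite -(q_chu_vandermonde 0); apply: eq_bigr => m _.
have z n : qpoch 0 q n = 1.
  by rewrite /qpoch big1 // => i _; rewrite mul0r subr0.
by rewrite !mul0r !z mul1r mulr1.
Qed.

Lemma triangular_sum (f : nat -> nat -> F) N :
  \sum_(n < N.+1) \sum_(r < n.+1) f n r
  = \sum_(r < N.+1) \sum_(m < (N - r).+1) f (r + m)%N r.
Proof.
elim: N => [|N IH]; first by rewrite !big_ord1.
rewrite big_ord_recr /= IH [in RHS]big_ord_recr /= subnn big_ord1 addn0.
rewrite (big_ord_recr N.+1) /= addrA; congr (_ + _).
rewrite -big_split /=; apply: eq_bigr => r _.
have lerN : (r <= N)%N by rewrite -ltnS.
by rewrite subSn // [RHS]big_ord_recr /= addnS subnKC.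
Qed.

Definition bailey_pair (a : F) (alpha beta : nat -> F) :=
  forall n, beta n = \sum_(r < n.+1)
    alpha r / (qpoch q q (n - r) * qpoch (a * q) q (n + r)).

Definition bailey_alpha (rho b : F) (alpha : nat -> F) r :=
  qpoch rho q r / qpoch b q r * (- b) ^+ r * q ^+ 'C(r, 2) * alpha r.

Definition bailey_sum (rho b : F) (beta : nat -> F) N :=
  \sum_(n < N.+1) qpoch rho q n * (- b) ^+ n * q ^+ 'C(n, 2) * beta n
     / qpoch q q (N - n).

Section Bailey.
Variable a : F.
Hypothesis aq_neq0 : forall n, qpoch (a * q) q n != 0.

(* The limit of Bailey's lemma where one of its two parameters tends to
   infinity; the other one is rho, and b stands for a q / rho. *)
Lemma bailey_lemma (rho b : F) (alpha beta : nat -> F) :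
    rho * b = a * q -> (forall n, qpoch b q n != 0) ->
  bailey_pair a alpha beta ->
  bailey_pair a (bailey_alpha rho b alpha)
    (fun N => bailey_sum rho b beta N / qpoch b q N).
Proof.
move=> rb b_neq0 pair N; rewrite /bailey_sum.
pose w n := qpoch rho q n * (- b) ^+ n * q ^+ 'C(n, 2) / qpoch q q (N - n).
rewrite (eq_bigr (fun n : 'I_N.+1 => \sum_(r < n.+1)
   w n * (alpha r / (qpoch q q (n - r) * qpoch (a * q) q (n + r)))));
  last first.
  by move=> n _; rewrite -mulr_sumr -pair /w; ring.
rewrite (triangular_sum (fun n r =>
   w n * (alpha r / (qpoch q q (n - r) * qpoch (a * q) q (n + r))))).
rewrite mulr_suml; apply: eq_bigr => r _.
have lerN : (r <= N)%N by rewrite -ltnS.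
set M := (N - r)%N.
have := q_chu_vandermonde (rho * q ^+ r) (b * q ^+ r) M.
have brM : qpoch b q N = qpoch b q r * qpoch (b * q ^+ r) q M.
  by rewrite -qpochD subnKC.
have br := b_neq0 r; have bN := b_neq0 N.
have brM0 : qpoch (b * q ^+ r) q M != 0.
  by move: bN; rewrite brM mulf_eq0 negb_or => /andP[].
have aNr : qpoch (a * q) q (N + r)
    = qpoch (a * q) q (r + r) * qpoch (a * q * q ^+ (r + r)) q M.
  by rewrite -qpochD /M; congr qpoch; lia.
have a2 := aq_neq0 (r + r); have aN := aq_neq0 (N + r).
have aM0 : qpoch (a * q * q ^+ (r + r)) q M != 0.
  by move: aN; rewrite aNr mulf_eq0 negb_or => /andP[].
move/(congr1 (fun x =>
  x * (qpoch rho q r * (- b) ^+ r * q ^+ 'C(r, 2) * alpha r)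
  / (qpoch (a * q) q (N + r) * qpoch b q N))) => H.
transitivity (qpoch (b * q ^+ r) q M / qpoch q q M *
  (qpoch rho q r * (- b) ^+ r * q ^+ 'C(r, 2) * alpha r)
  / (qpoch (a * q) q (N + r) * qpoch b q N)); last first.
  by rewrite /bailey_alpha brM; field; rewrite br brM0 aN qq_neq0.
rewrite -H !mulr_suml; apply: eq_bigr => m _.
have lemM : (m <= M)%N by rewrite -ltnS.
have -> : rho * q ^+ r * (b * q ^+ r) = a * q * q ^+ (r + r).
  by rewrite exprD -rb; ring.
rewrite /w addKn (qpochD rho) subnDA -/M.
have -> : 'C(r + m, 2) = ('C(r, 2) + 'C(m, 2) + r * m)%N.
  elim: (nat_of_ord m) => [|k IHk]; first by rewrite !addn0 muln0 addn0.
  by rewrite addnS !binS !bin1 IHk mulnS; lia.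
have aM : qpoch (a * q * q ^+ (r + r)) q M =
   qpoch (a * q * q ^+ (r + r)) q m
   * qpoch (a * q * q ^+ (r + r) * q ^+ m) q (M - m).
  by rewrite -qpochD subnKC.
have am0 : qpoch (a * q * q ^+ (r + r)) q m != 0
  by move: aM0; rewrite aM mulf_eq0 negb_or => /andP[].
have aMm0 : qpoch (a * q * q ^+ (r + r) * q ^+ m) q (M - m) != 0
  by move: aM0; rewrite aM mulf_eq0 negb_or => /andP[].
rewrite aNr aM (_ : (r + m + r = r + r + m)%N); last by lia.
rewrite (qpochD (a * q)) (exprD _ r m) (exprD _ _ (r * m)) (exprD _ 'C(r, 2)).
rewrite -(mulNr b) exprMn exprM.
by field; rewrite bN aMm0 am0 a2 !qq_neq0.
Qed.

Definition unit_alpha r : F :=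
  if r is s.+1 then (-1) ^+ r * q ^+ 'C(r, 2) * (1 - a * q ^+ (r + r))
                    * qpoch (a * q) q s / qpoch q q r
  else 1.

(* The partial sums of the unit pair telescope. *)
Lemma unit_bailey_pair : bailey_pair a unit_alpha (fun n => (n == 0%N)%:R).
Proof.
case=> [|n]; first by rewrite big_ord1 /= addn0 subn0 !qpoch0 mulr1 divr1.
have partial m : (m <= n)%N -> (1 - q ^+ n.+1) * \sum_(r < m.+1)
    unit_alpha r / (qpoch q q (n.+1 - r) * qpoch (a * q) q (n.+1 + r))
  = (-1) ^+ m * q ^+ 'C(m.+1, 2) * qpoch (a * q) q m
    / (qpoch q q m * qpoch q q (n - m) * qpoch (a * q) q (n.+1 + m)).
  elim: m => [_|m IH ltmn].
    rewrite big_ord1 /= !qpoch0 addn0 !subn0 (qpochS q) -exprS.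
    have := subq_neq0 n; rewrite -exprS => h.
    by rewrite bin_small // ?expr0; field; rewrite qq_neq0 h aq_neq0.
  rewrite big_ord_recr /= mulrDr IH 1?ltnW //.
  rewrite subSS (addnS n.+1 m) (qpochS (a * q) (n.+1 + m)).
  have nm : (n - m = (n - m.+1).+1)%N by lia.
  rewrite nm !(qpochS q) (qpochS (a * q) m).
  have h1 := subq_neq0 m; have h2 := subq_neq0 (n - m.+1).
  have h3 : 1 - a * q * q ^+ (n.+1 + m) != 0.
    have := aq_neq0 (n.+1 + m).+1.
    by rewrite qpochS mulf_eq0 negb_or => /andP[].
  have e : q ^+ n = q ^+ (n - m.+1) * q ^+ m * q.
    by rewrite -exprD -exprSr; congr (_ ^+ _); lia.
  move: h1 h2 h3.
  rewrite !expr_bin2S !addSn !addnS !exprS !exprD e => h1 h2 h3.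
  by field; rewrite !qq_neq0 h1 h2 h3 aq_neq0.
apply/esym/(mulfI (subq_neq0 n)).
rewrite -exprS big_ord_recr mulrDr partial // subnn /= mulr0.
rewrite subnn (addnS n.+1 n) (qpochS (a * q) (n.+1 + n)) !(qpochS q).
have h3 : 1 - a * q * q ^+ (n.+1 + n) != 0.
  have := aq_neq0 (n.+1 + n).+1.
  by rewrite qpochS mulf_eq0 negb_or => /andP[].
have h1 := subq_neq0 n.
move: h1 h3.
rewrite !qpoch0 !expr_bin2S !addSn !exprS !exprD => h1 h3.
by field; rewrite !qq_neq0 h1 h3 aq_neq0.
Qed.

(* Bailey's lemma applied twice to the unit pair: a limiting case of Watson's
   8phi7 transformation, with b = a q / rho and c = a q / sigma. *)
Lemma watson_pair (rho b sigma c : F) :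
    rho * b = a * q -> (forall n, qpoch b q n != 0) ->
    sigma * c = a * q -> (forall n, qpoch c q n != 0) ->
  bailey_pair a (bailey_alpha rho b (bailey_alpha sigma c unit_alpha))
    (fun N => bailey_sum rho b (fun n => (qpoch q q n * qpoch c q n)^-1) N
              / qpoch b q N).
Proof.
move=> rb b_neq0 sc c_neq0.
apply: bailey_lemma => // n.
rewrite -(bailey_lemma sc c_neq0 unit_bailey_pair) /bailey_sum.
rewrite big_ord_recl big1 ?addr0 /=; last by move=> i _; rewrite mulr0 mul0r.
by rewrite subn0 !qpoch0 expr0 !mul1r invfM.
Qed.
End Bailey.

Lemma qpoch_reflect (z : F) N : z != 0 ->
  qpoch (z * q ^- N) q N = (- z) ^+ N * q ^- 'C(N.+1, 2) * qpoch (q / z) q N.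
Proof.
move=> z_neq0.
elim: N => [|N IH]; first by rewrite !qpoch0 bin_small // !expr0 invr1 !mulr1.
rewrite qpochSl (_ : z * q ^- N.+1 * q = z * q ^- N); last first.
  by rewrite exprSr; field; rewrite q_neq0 expf_neq0.
rewrite IH (expr_bin2S N.+1) qpochS (exprS q) (exprS (- z)).
by field; rewrite z_neq0 q_neq0 !expf_neq0.
Qed.

Lemma triple_product_pair (z : F) : z != 0 ->
  bailey_pair q
    (fun s => (-1) ^+ s * q ^+ 'C(s.+1, 2) * z ^- s * (1 - z ^+ (s + s).+1)
              / (1 - q))
    (fun N => qpoch z q N.+1 * qpoch (q / z) q N / qpoch q q (N + N).+1).
Proof.
move=> z_neq0 N.
have q1 := subq_neq0 0; rewrite expr0 mulr1 in q1.
have qq2 n : qpoch (q * q) q n != 0.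
  by have := qq_neq0 n.+1; rewrite qpochSl mulf_eq0 negb_or => /andP[].
have zN := qpoch_reflect N z_neq0.
pose f m := (- (z * q ^- N)) ^+ m * q ^+ 'C(m, 2)
  / (qpoch q q m * qpoch q q (N + N.+1 - m)).
have H : \sum_(m < N.+1 + N.+1) f m
    = qpoch (z * q ^- N) q (N + N.+1) / qpoch q q (N + N.+1).
  exact: q_binomial.
rewrite qpochD mulfVK ?expf_neq0 // zN in H.
transitivity ((\sum_(m < N.+1 + N.+1) f m) / ((- z) ^+ N * q ^- 'C(N.+1, 2))).
  rewrite H -addnS; field.
  by rewrite ?q_neq0 ?z_neq0 ?expf_neq0 ?oppr_eq0 // ?qq_neq0.
rewrite mulr_suml big_split_ord /= addrC.
rewrite [X in _ + X](reindex_inj rev_ord_inj) /= -big_split /=.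
apply: eq_bigr => s _.
have lesN : (s <= N)%N by rewrite -ltnS.
have e1 : q ^+ 'C(N.+1 + s, 2) * q ^+ 'C(N.+1, 2)
    = q ^+ N ^+ (N.+1 + s) * q ^+ 'C(s.+1, 2).
  rewrite -exprM -!exprD; congr (_ ^+ _).
  have := bin2_sqr (N.+1 + s); have := bin2_sqr N.+1; have := bin2_sqr s.+1.
  by nia.
have e2 : q ^+ 'C(N - s, 2) * q ^+ 'C(N.+1, 2)
    = q ^+ N ^+ (N - s) * q ^+ 'C(s.+1, 2).
  rewrite -exprM -!exprD; congr (_ ^+ _).
  have := bin2_sqr (N - s); have := bin2_sqr N.+1; have := bin2_sqr s.+1.
  by nia.
rewrite /f subSS.
have -> : (N + N.+1 - (N.+1 + s) = N - s)%N by lia.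
have -> : (N + N.+1 - (N - s) = (N + s).+1)%N by lia.
rewrite !addSn qpochSl.
have {}e1 : q ^+ 'C((N + s).+1, 2)
    = q ^+ N ^+ (N.+1 + s) * q ^+ 'C(s.+1, 2) / q ^+ 'C(N.+1, 2).
  by rewrite -e1 mulfK ?expf_neq0.
have {}e2 : q ^+ 'C(N - s, 2)
    = q ^+ N ^+ (N - s) * q ^+ 'C(s.+1, 2) / q ^+ 'C(N.+1, 2).
  by rewrite -e2 mulfK ?expf_neq0.
rewrite e1 e2 addSn -!mulNr !exprMn !exprVn.
have zNs : (- z) ^+ (N - s) = (- z) ^+ N * ((-1) ^+ s / z ^+ s).
  have -> : (- z) ^+ N = (- z) ^+ (N - s) * ((-1) ^+ s * z ^+ s).
    by rewrite -exprMn mulN1r -exprD subnK.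
  transitivity ((- z) ^+ (N - s) * ((-1) ^+ s * (-1) ^+ s)).
    by rewrite -exprD -signr_odd addnn odd_double mulr1.
  by field; rewrite expf_neq0.
have m1 : (- z) ^+ (N + s).+1 = - (- z) ^+ N * ((-1) ^+ s * z ^+ s) * z.
  by rewrite exprS exprD -exprMn mulN1r; ring.
rewrite m1 zNs (exprS z (s + s)) (exprD z s s).
field.
by rewrite qq2 qq_neq0 q1 ?expf_neq0 ?oppr_eq0.
Qed.
End QSeries.

(** * Limits of complex sequences *)

Section Limits.
Variable K : numFieldType.
Implicit Types (u v : nat -> K) (a b : K).

Lemma lim_cst a : (fun _ : nat => a) @ \oo --> a.
Proof. exact: cvg_cst. Qed.

Lemma limD u v a b :
  u @ \oo --> a -> v @ \oo --> b -> (fun n => u n + v n) @ \oo --> a + b.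
Proof. exact: cvgD. Qed.

Lemma limM u v a b :
  u @ \oo --> a -> v @ \oo --> b -> (fun n => u n * v n) @ \oo --> a * b.
Proof. exact: cvgM. Qed.

Lemma limV u a : a != 0 -> u @ \oo --> a -> (fun n => (u n)^-1) @ \oo --> a^-1.
Proof. exact: cvgV. Qed.

Lemma lim_unique u a b : u @ \oo --> a -> u @ \oo --> b -> a = b.
Proof. by move=> ua ub; rewrite -(cvg_lim _ ua) // -(cvg_lim _ ub). Qed.

Lemma lim_eq u a : u @ \oo --> a -> lim (u @ \oo) = a.
Proof. by move=> ua; exact: cvg_lim. Qed.

Lemma lim_subseq u a (h : nat -> nat) : (forall n, n <= h n)%N ->
  u @ \oo --> a -> (fun n => u (h n)) @ \oo --> a.
Proof.
move=> hn ua; apply: (cvg_comp h u _ ua) => P [N _ NP].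
by exists N => // n Nn; apply: NP; exact: leq_trans (hn n).
Qed.

Lemma lim_shift u a : (fun n => u n.+1) @ \oo --> a -> u @ \oo --> a.
Proof. by rewrite -(cvg_shiftS u). Qed.

Lemma lim_ext_near u v a n0 : (forall n, (n0 <= n)%N -> u n = v n) ->
  u @ \oo --> a -> v @ \oo --> a.
Proof.
move=> uv; apply: cvg_trans; apply: near_eq_cvg.
by exists n0 => // n /= /uv.
Qed.

Lemma lim_ext u v a : u =1 v -> u @ \oo --> a -> v @ \oo --> a.
Proof. by move=> /funext ->. Qed.

Lemma lim_norm_lt u a : u @ \oo --> a <->
  forall e, 0 < e -> exists N, forall n, (N <= n)%N -> `|a - u n| < e.
Proof.
split=> [/cvgrPdist_lt h e /h [N _ Nh]|h]; first by exists N => n /Nh.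
by apply/cvgrPdist_lt => e /h [N Nh]; exists N.
Qed.
End Limits.

Section Complex.
Variable R : realType.
Implicit Types (u v : nat -> R[i]) (a b z : R[i]) (s A B : R).
Local Notation normc := ComplexField.Normc.normc.

Lemma normcEC z : `|z| = (normc z)%:C%C.
Proof. by case: z => x y; rewrite normc_def. Qed.

Lemma normc_ge0 z : 0 <= normc z.
Proof. by have := normr_ge0 z; rewrite normcEC lecR. Qed.

Lemma normcD z w : normc (z + w) <= normc z + normc w.
Proof. by have := ler_normD z w; rewrite !normcEC -rmorphD lecR. Qed.

Lemma normcN z : normc (- z) = normc z.
Proof. by apply: complexI; rewrite -!normcEC normrN. Qed.

Lemma normcX z n : normc (z ^+ n) = normc z ^+ n.
Proof.
elim: n => [|n IH]; first exact: ComplexField.Normc.normc1.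
by rewrite !exprS ComplexField.Normc.normcM IH.
Qed.

Lemma normc_sum (I : Type) (r : seq I) (F : I -> R[i]) :
  normc (\sum_(i <- r) F i) <= \sum_(i <- r) normc (F i).
Proof.
elim: r => [|i r IH]; first by rewrite !big_nil ComplexField.Normc.normc0.
rewrite !big_cons; apply: le_trans (normcD _ _) _.
by rewrite lerD2l.
Qed.

Lemma lim_normcP u a : u @ \oo --> a <->
  forall e : R, 0 < e -> exists N, forall n, (N <= n)%N -> normc (a - u n) < e.
Proof.
split=> [/lim_norm_lt h e e0|h].
  have /h [N Nh] : 0 < e%:C%C by rewrite ltcR.
  by exists N => n /Nh; rewrite normcEC ltcR.
apply/lim_norm_lt => e e0.
have eE : e = (complex.Re e)%:C%C.
  by case: e e0 => x y; rewrite ltcE /= => /andP[/eqP -> _].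
have /h [N Nh] : 0 < complex.Re e by rewrite -ltcR -eE.
by exists N => n /Nh; rewrite normcEC eE ltcR.
Qed.

Lemma normc_lim_le u a B :
  (forall n, normc (u n) <= B) -> u @ \oo --> a -> normc a <= B.
Proof.
move=> uB /lim_normcP ua; rewrite leNgt; apply/negP => Ba.
have /ua [N /(_ N (leqnn N))] : 0 < normc a - B by rewrite subr_gt0.
apply/negP; rewrite -leNgt lerBlDr.
have := normcD (a - u N) (u N); rewrite subrK => /le_trans; apply.
by rewrite lerD2l.
Qed.

Lemma expr_lt_eps s e : 0 <= s < 1 -> 0 < e ->
  exists N, forall n, (N <= n)%N -> s ^+ n < e.
Proof.
move=> /andP[s0 s1] e0.
have /cvg_expr /cvgrPdist_lt /(_ _ e0) [N _ Nh] : `|s| < 1 by rewrite ger0_norm.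
by exists N => n /Nh /=; rewrite sub0r normrN ger0_norm ?exprn_ge0.
Qed.

Lemma geometric_tail s m n : 0 <= s < 1 ->
  \sum_(m <= k < n) s ^+ k <= s ^+ m / (1 - s).
Proof.
move=> /andP[s0 s1]; have s1' : 0 < 1 - s by rewrite subr_gt0.
have [mn|nm] := leqP m n; last first.
  by rewrite big_geq 1?ltnW // divr_ge0 ?exprn_ge0 // ltW.
rewrite ler_pdivlMr // mulr_suml.
rewrite (eq_big_nat _ _ (F2 := fun k => - (s ^+ k.+1 - s ^+ k))); last first.
  by move=> k _; rewrite exprS; ring.
by rewrite sumrN telescope_sumr // opprB lerBlDr lerDl exprn_ge0.
Qed.

Lemma tannery0 (d : nat -> nat -> R[i]) A s : 0 <= s < 1 ->
    (forall n k, normc (d n k) <= A * s ^+ k) ->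
    (forall k, d ^~ k @ \oo --> 0) ->
  (fun n => \sum_(k < n) d n k) @ \oo --> 0.
Proof.
move=> s01 dA dk; have /andP[s0 s1] := s01.
have s1' : 0 < 1 - s by rewrite subr_gt0.
have A0 : 0 <= A.
  by have := le_trans (normc_ge0 _) (dA 0%N 0%N); rewrite expr0 mulr1.
apply/lim_normcP => e e0.
pose e' := e / 2 / (A + 1) * (1 - s).
have e'0 : 0 < e' by rewrite mulr_gt0 // !divr_gt0 // ltr_wpDl.
have [K0 /(_ K0 (leqnn _)) sK] := expr_lt_eps s01 e'0.
have /lim_normcP headK : (fun n => \sum_(k < K0) d n k) @ \oo --> 0.
  elim: K0 {sK} => [|K IH].
    by under eq_fun do rewrite big_ord0; exact: lim_cst.
  under eq_fun do rewrite big_ord_recr /=.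
  by have := limD IH (dk K); rewrite addr0.
have [|N headN] := headK (e / 2); first by rewrite divr_gt0.
exists (maxn K0 N) => n; rewrite geq_max => /andP[Kn /headN].
rewrite !sub0r !normcN => head.
rewrite -(big_mkord xpredT (fun k => d n k)) (@big_cat_nat _ _ _ K0) //=.
rewrite big_mkord.
apply: le_lt_trans (normcD _ _) _.
rewrite [X in _ < X]splitr; apply: ltr_leD => //.
apply: le_trans (normc_sum _ _) _.
apply: (@le_trans _ _ (\sum_(K0 <= k < n) A * s ^+ k)); first exact: ler_sum.
rewrite -mulr_sumr.
apply: (@le_trans _ _ ((A + 1) * (s ^+ K0 / (1 - s)))).
  apply: ler_pM => //; first by apply: sumr_ge0 => k _; rewrite exprn_ge0.
    by rewrite lerDl.
  exact: geometric_tail.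
rewrite mulrA ler_pdivrMr // mulrC -ler_pdivlMr ?ltr_wpDl //.
by apply: ltW; apply: lt_le_trans sK _; rewrite /e' mulrAC.
Qed.

Lemma tannery (f : nat -> nat -> R[i]) (g : nat -> R[i]) A s : 0 <= s < 1 ->
    (forall n k, normc (f n k) <= A * s ^+ k) ->
    (forall k, f ^~ k @ \oo --> g k) ->
  (fun n => \sum_(k < n) f n k - \sum_(k < n) g k) @ \oo --> 0.
Proof.
move=> s01 fA fg.
under eq_fun do rewrite -sumrB.
apply: (@tannery0 (fun n k => f n k - g k) (A + A) s s01) => [n k|k].
  apply: le_trans (normcD _ _) _.
  rewrite normcN mulrDl lerD //.
  by apply: normc_lim_le (fg k) => m; exact: fA.
by have := limD (fg k) (@lim_cst _ (- g k)); rewrite subrr.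
Qed.

Lemma tannery_lim (f : nat -> nat -> R[i]) (g : nat -> R[i]) A s (L : R[i]) :
    0 <= s < 1 ->
    (forall n k, normc (f n k) <= A * s ^+ k) ->
    (forall k, f ^~ k @ \oo --> g k) ->
  (fun n => \sum_(k < n) f n k) @ \oo --> L <->
  (fun n => \sum_(k < n) g k) @ \oo --> L.
Proof.
move=> s01 fA fg; have h := tannery s01 fA fg; split=> hL.
- have := limD hL (limM (@lim_cst _ (- 1)) h); rewrite mulr0 addr0.
  by under eq_fun do rewrite mulN1r opprB addrC subrK.
- have := limD hL h; rewrite addr0.
  by under eq_fun do rewrite addrC subrK.
Qed.

Lemma geometric_cvg u B s : 0 <= s < 1 ->
    (forall n, normc (u n.+1 - u n) <= B * s ^+ n) ->
  exists l : R[i], u @ \oo --> l.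
Proof.
move=> s01 uB; have /andP[s0 s1] := s01.
have B0 : 0 <= B.
  by have := le_trans (normc_ge0 _) (uB 0%N); rewrite expr0 mulr1.
have cvgR (x : nat -> R) : (forall n, `|x n.+1 - x n| <= B * s ^+ n) ->
    exists l : R, x @ \oo --> l.
  move=> xB; pose y n := x n.+1 - x n.
  have cy : cvgn (series y).
    apply: normed_cvg; apply: (@series_le_cvg _ _ (geometric B s)) => //.
      by move=> n /=; exact: normr_ge0.
      by move=> n /=; rewrite mulr_ge0 ?exprn_ge0.
    by apply: is_cvg_geometric_series; rewrite ger0_norm.
  exists (x 0%N + limn (series y)).
  have := limD (@lim_cst R (x 0%N)) cy.
  suff -> : (fun n => x 0%N + series y n) = x by [].
  by apply/funext => n; rewrite /series /= telescope_sumr // addrC subrK.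
have normRe z : `|complex.Re z| <= normc z /\ `|complex.Im z| <= normc z.
  case: z => x y /=; rewrite -!sqrtr_sqr; split; apply: ler_wsqrtr.
    by rewrite lerDl sqr_ge0.
  by rewrite lerDr sqr_ge0.
have [|a /cvgrPdist_lt ha] := cvgR (fun n => complex.Re (u n)).
  move=> n; apply: le_trans (uB n).
  by have [] := normRe (u n.+1 - u n); case: (u n.+1) => ? ?; case: (u n).
have [|b /cvgrPdist_lt hb] := cvgR (fun n => complex.Im (u n)).
  move=> n; apply: le_trans (uB n).
  by have [_] := normRe (u n.+1 - u n); case: (u n.+1) => ? ?; case: (u n).
exists (a +i* b)%C; apply/lim_normcP => e e0.
have e20 : 0 < e / 2 by rewrite divr_gt0.
have [N1 _ h1] := ha _ e20; have [N2 _ h2] := hb _ e20.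
exists (maxn N1 N2) => n; rewrite geq_max => /andP[/h1 /= {}h1 /h2 /= {}h2].
have -> : (a +i* b)%C - u n
  = (a - complex.Re (u n))%:C%C + (0 +i* (b - complex.Im (u n)))%C.
  by case: (u n) => x y; apply/eqP; rewrite eq_complex /= addr0 add0r !eqxx.
apply: le_lt_trans (normcD _ _) _.
rewrite /= !expr0n /= addr0 add0r !sqrtr_sqr (splitr e).
exact: ltrD.
Qed.
End Complex.

(** * q-Pochhammer symbols in the unit disk *)

Section QAnalysis.
Variable R : realType.
Local Notation normc := ComplexField.Normc.normc.
Implicit Types (q a b c x z : R[i]) (r s A B : R).

Lemma lim_subn (u : nat -> R[i]) (l : R[i]) k :
  u @ \oo --> l -> (fun n => u (n - k)%N) @ \oo --> l.
Proof.
move=> /lim_normcP ul; apply/lim_normcP => e /ul [N Nh].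
exists (N + k)%N => n h; apply: Nh.
by rewrite leq_subRL ?(leq_trans _ h) ?leq_addl // addnC.
Qed.

Lemma convolution_lim (c u v : nat -> R[i]) A B s (U V L : R[i]) : 0 <= s < 1 ->
    (forall k, normc (c k) <= A * s ^+ k) ->
    (forall k, normc (u k) <= B) -> (forall k, normc (v k) <= B) ->
    u @ \oo --> U -> v @ \oo --> V -> U != 0 -> V != 0 ->
  (fun n => \sum_(k < n.+1) c k * (u (n - k)%N * v (n + k)%N)) @ \oo
    --> L * (U * V) <->
  (fun n => \sum_(k < n) c k) @ \oo --> L.
Proof.
move=> s01 cA uB vB uU vV U0 V0; have /andP[s0 _] := s01.
have B0 : 0 <= B := le_trans (normc_ge0 _) (uB 0%N).
pose f n k := c k * (u (n - k.+1)%N * v (n.-1 + k)%N).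
have fA n k : normc (f n k) <= A * (B * B) * s ^+ k.
  rewrite /f !ComplexField.Normc.normcM mulrAC.
  by rewrite ler_pM ?mulr_ge0 ?normc_ge0 // ler_pM ?normc_ge0.
have fg k : f ^~ k @ \oo --> c k * (U * V).
  apply: limM; first exact: lim_cst.
  apply: limM; first exact: lim_subn.
  by apply: lim_shift; apply: lim_subseq vV => n /=; rewrite leq_addr.
have UV0 : U * V != 0 by rewrite mulf_neq0.
have [h1 h2] := tannery_lim (L * (U * V)) s01 fA fg.
split=> h.
- have := limM (h1 (lim_shift h)) (@lim_cst _ (U * V)^-1).
  rewrite (mulfK UV0); apply: lim_ext => n.
  by rewrite -mulr_suml (mulfK UV0).
- suff : (fun n => \sum_(k < n.+1) f n.+1 k) @ \oo --> L * (U * V) by [].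
  apply: (@lim_subseq _ (fun n => \sum_(k < n) f n k) _ S leqnSn).
  apply: h2; apply: lim_ext (limM h (@lim_cst _ (U * V))) => n.
  exact: mulr_suml.
Qed.

Section Base.
Variable q : R[i].
Hypothesis q_lt1 : normc q < 1.
Let r := normc q.
Let r0 : 0 <= r. Proof. exact: normc_ge0. Qed.
Let r1 : 0 < 1 - r. Proof. by rewrite subr_gt0. Qed.

Lemma qpochR_le (w : R) n : 0 <= w -> qpoch (- w) r n <= expR (w / (1 - r)).
Proof.
move=> w0; apply: (@le_trans _ _ (expR (\sum_(k < n) w * r ^+ k))).
  rewrite expR_sum; apply: ler_prod => k _; rewrite mulNr opprK expR_ge1Dx.
  by rewrite addr_ge0 // mulr_ge0 ?exprn_ge0.
rewrite ler_expR -mulr_sumr ler_wpM2l //.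
have := @geometric_tail _ r 0 n; rewrite big_mkord expr0 div1r; apply.
by rewrite r0.
Qed.

Lemma normc_qpoch_le a n : normc (qpoch a q n) <= qpoch (- normc a) r n.
Proof.
elim: n => [|n IH]; first by rewrite !qpoch0 ComplexField.Normc.normc1.
rewrite !qpochS ComplexField.Normc.normcM ler_pM ?normc_ge0 //.
apply: le_trans (normcD _ _) _; rewrite ComplexField.Normc.normc1.
by rewrite normcN ComplexField.Normc.normcM normcX mulNr opprK.
Qed.

Lemma normc_factor_ge a n :
  normc a < 1 -> 1 - normc a * r ^+ n <= normc (1 - a * q ^+ n).
Proof.
move=> a1; have := normcD (1 - a * q ^+ n) (a * q ^+ n).
rewrite subrK ComplexField.Normc.normc1 ComplexField.Normc.normcM normcX.
by rewrite lerBlDr.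
Qed.

Lemma factorR_gt0 a n : normc a < 1 -> 0 < 1 - normc a * r ^+ n.
Proof.
move=> a1; rewrite subr_gt0; apply: le_lt_trans a1.
by rewrite ler_piMr ?normc_ge0 // exprn_ile1 // ltW.
Qed.

Lemma qpoch_neq0 a n : normc a < 1 -> qpoch a q n != 0.
Proof.
move=> a1; apply/prodf_neq0 => k _; apply/eqP => h.
have := lt_le_trans (factorR_gt0 k a1) (normc_factor_ge k a1).
by rewrite h ComplexField.Normc.normc0 ltxx.
Qed.

Lemma normc_qpochV_le a n : normc a < 1 ->
  normc (qpoch a q n)^-1 <= expR ((1 - normc a)^-1 / (1 - r)).
Proof.
move=> a1; have a1' : 0 < 1 - normc a by rewrite subr_gt0.
apply: le_trans _ (qpochR_le n _); last by rewrite invr_ge0 ltW.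
elim: n => [|n IH].
  by rewrite !qpoch0 invr1 ComplexField.Normc.normc1.
rewrite !qpochS invfM ComplexField.Normc.normcM ler_pM ?normc_ge0 //.
have t0 := factorR_gt0 n a1.
rewrite ComplexField.Normc.normcV.
apply: (@le_trans _ _ (1 - normc a * r ^+ n)^-1).
  rewrite lef_pV2 ?posrE //; first exact: normc_factor_ge.
  exact: lt_le_trans t0 (normc_factor_ge _ a1).
rewrite -div1r ler_pdivrMr // mulNr opprK.
have a0 := normc_ge0 a.
have rn : 0 <= r ^+ n <= 1 by rewrite exprn_ge0 //= exprn_ile1 // ltW.
have /andP[rn0 rn1] := rn.
have -> : (1 + (1 - normc a)^-1 * r ^+ n) * (1 - normc a * r ^+ n)
  = 1 + r ^+ n / (1 - normc a) * (normc a * (normc a - r ^+ n) + (1 - normc a)).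
  by field; rewrite gt_eqF.
rewrite lerDl mulr_ge0 ?divr_ge0 // ?(ltW a1') //.
nra.
Qed.

Lemma qpoch_cvg a : (fun n => qpoch a q n) @ \oo --> qpoch_inf a q.
Proof.
have [||l al] := @geometric_cvg R (fun n => qpoch a q n)
    (expR (normc a / (1 - r)) * normc a) r; first by rewrite r0.
  move=> n; rewrite qpochS mulrBr mulr1 addrAC subrr add0r normcN.
  rewrite !ComplexField.Normc.normcM normcX mulrA ler_wpM2r ?exprn_ge0 //.
  rewrite ler_wpM2r ?normc_ge0 //; apply: le_trans (normc_qpoch_le _ _) _.
  by rewrite qpochR_le ?normc_ge0.
by rewrite /qpoch_inf (lim_eq al).
Qed.

Lemma qpoch_inf_neq0 a : normc a < 1 -> qpoch_inf a q != 0.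
Proof.
move=> a1; apply/eqP => a0; have := @qpoch_cvg a; rewrite a0 => /lim_normcP.
set B := expR ((1 - normc a)^-1 / (1 - r)).
have B0 : 0 < B := expR_gt0 _.
move=> /(_ B^-1) []; first by rewrite invr_gt0.
move=> N /(_ N (leqnn N)); rewrite sub0r normcN; apply/negP; rewrite -leNgt.
have uN := qpoch_neq0 N a1.
have nN : 0 < normc (qpoch a q N).
  rewrite lt_neqAle normc_ge0 andbT eq_sym.
  by apply: contra uN => /eqP/ComplexField.Normc.eq0_normc ->.
rewrite -[leRHS]invrK lef_pV2 ?posrE ?invr_gt0 //.
by have := normc_qpochV_le N a1; rewrite ComplexField.Normc.normcV.
Qed.

Lemma qpoch_infD a n : qpoch_inf a q = qpoch a q n * qpoch_inf (a * q ^+ n) q.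
Proof.
apply: (lim_unique (u := fun m => qpoch a q (n + m))).
  by apply: (lim_subseq _ (@qpoch_cvg a)) => m; exact: leq_addl.
apply: lim_ext (limM (@lim_cst _ (qpoch a q n)) (@qpoch_cvg (a * q ^+ n))) => m.
by rewrite qpochD.
Qed.

Lemma qpochV_cvg a : normc a < 1 ->
  (fun n => (qpoch a q n)^-1) @ \oo --> (qpoch_inf a q)^-1.
Proof. by move=> a1; apply: limV (@qpoch_cvg a); exact: qpoch_inf_neq0. Qed.

Lemma theta_majorant B : 0 <= B ->
  exists A, forall k, B ^+ k * r ^+ 'C(k, 2) <= A * (1 / 2) ^+ k.
Proof.
move=> B0; pose v k := (B + B) ^+ k * r ^+ 'C(k, 2).
have v0 k : 0 <= v k by rewrite mulr_ge0 ?exprn_ge0 ?addr_ge0.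
have [||N Nh] := @expr_lt_eps R r (B + B + 1)^-1; first by rewrite r0.
  by rewrite invr_gt0 ltr_wpDl ?addr_ge0.
have vN k : (N <= k)%N -> v k.+1 <= v k.
  move=> /Nh rk; rewrite /v exprS binS bin1 exprD.
  have -> : (B + B) * (B + B) ^+ k * (r ^+ 'C(k, 2) * r ^+ k)
    = v k * ((B + B) * r ^+ k) by rewrite /v; ring.
  rewrite ler_piMr //.
  apply: (@le_trans _ _ ((B + B + 1) * (B + B + 1)^-1)).
    by rewrite ler_pM ?addr_ge0 ?exprn_ge0 ?lerDl // ltW.
  by rewrite divff // gt_eqF // ltr_wpDl ?addr_ge0.
exists (\sum_(k < N.+1) v k) => k.
have -> : B ^+ k * r ^+ 'C(k, 2) = v k * (1 / 2) ^+ k.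
  by rewrite /v mulrAC -exprMn; congr (_ ^+ _ * _); field.
rewrite ler_wpM2r ?exprn_ge0 ?divr_ge0 //.
have vS m : (m <= N)%N -> v m <= \sum_(k < N.+1) v k.
  move=> mN; rewrite (bigD1 (Ordinal (mN : (m < N.+1)%N))) //= lerDl.
  exact: sumr_ge0.
have [kN|/ltnW Nk] := leqP k N; first exact: vS.
rewrite -(subnKC Nk); elim: (k - N)%N => [|m IH]; first by rewrite addn0 vS.
by rewrite addnS; apply: le_trans IH; apply: vN; exact: leq_addr.
Qed.

Let qq_neq0 n : qpoch q q n != 0. Proof. exact: qpoch_neq0. Qed.

Definition euler_term x k : R[i] := x ^+ k * q ^+ 'C(k, 2) / qpoch q q k.

Lemma normc_euler_term x : exists2 B, 0 <= B &
  forall k, normc (euler_term x k) <= B * (normc x ^+ k * r ^+ 'C(k, 2)).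
Proof.
exists (expR ((1 - normc q)^-1 / (1 - r))); first exact: expR_ge0.
move=> k; rewrite /euler_term !ComplexField.Normc.normcM !normcX mulrC.
rewrite ler_wpM2r ?mulr_ge0 ?exprn_ge0 ?normc_ge0 //.
exact: normc_qpochV_le.
Qed.

Lemma euler_cvg x :
  (fun n => \sum_(k < n) euler_term x k) @ \oo --> qpoch_inf (- x) q.
Proof.
have [B B0 xB] := normc_euler_term x.
have [A hA] := theta_majorant (normc_ge0 x).
have B1 : normc (1 : R[i]) <= Num.max 1 (expR ((1 - normc q)^-1 / (1 - r))).
  by rewrite ComplexField.Normc.normc1 le_max lexx.
have qB n : normc (qpoch q q n)^-1
    <= Num.max 1 (expR ((1 - normc q)^-1 / (1 - r))).
  by rewrite le_max normc_qpochV_le ?orbT.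
have s01 : 0 <= (1 / 2 : R) < 1 by apply/andP; split; lra.
have cA k : normc (euler_term x k) <= B * A * (1 / 2) ^+ k.
  by apply: le_trans (xB k) _; rewrite -mulrA ler_wpM2l.
have q_inf0 : (qpoch_inf q q)^-1 != 0 by rewrite invr_eq0 qpoch_inf_neq0.
have [h _] := @convolution_lim _ (fun n => (qpoch q q n)^-1) (fun=> 1) _ _ _
  _ _ (qpoch_inf (- x) q) s01 cA qB (fun=> B1) (qpochV_cvg q_lt1)
  (@lim_cst _ 1) q_inf0 (oner_neq0 _).
apply: h.
rewrite mulr1; apply: lim_ext (limM (@qpoch_cvg (- x)) (qpochV_cvg q_lt1)) => n.
rewrite /= -q_binomial //; apply: eq_bigr => k _.
by rewrite opprK /euler_term invfM mulr1 mulrA.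
Qed.

Lemma bailey_lim a (alpha beta : nat -> R[i]) A s (L : R[i]) : normc a <= 1 ->
    0 <= s < 1 -> (forall k, normc (alpha k) <= A * s ^+ k) ->
    bailey_pair q a alpha beta ->
  beta @ \oo --> L / (qpoch_inf q q * qpoch_inf (a * q) q) <->
  (fun n => \sum_(k < n) alpha k) @ \oo --> L.
Proof.
move=> a1 s01 hA pair.
have aq1 : normc (a * q) < 1.
  apply: le_lt_trans q_lt1; rewrite ComplexField.Normc.normcM.
  by rewrite ler_piMl ?normc_ge0.
set B1 := expR ((1 - normc q)^-1 / (1 - r)).
set B2 := expR ((1 - normc (a * q))^-1 / (1 - r)).
have h := @convolution_lim alpha (fun n => (qpoch q q n)^-1)
  (fun n => (qpoch (a * q) q n)^-1) A (Num.max B1 B2) s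
  (qpoch_inf q q)^-1 (qpoch_inf (a * q) q)^-1 L s01 hA.
have -> : beta = (fun n => \sum_(k < n.+1)
   alpha k * ((qpoch q q (n - k))^-1 * (qpoch (a * q) q (n + k))^-1)).
  by apply/funext => n; rewrite pair; apply: eq_bigr => k _; rewrite invfM.
rewrite invfM; apply: h; rewrite ?invr_eq0 ?qpoch_inf_neq0 //.
- by move=> k; rewrite le_max normc_qpochV_le.
- by move=> k; rewrite le_max normc_qpochV_le ?orbT.
- exact: qpochV_cvg.
- exact: qpochV_cvg.
Qed.
End Base.
End QAnalysis.

(** * Reduction of the triple sums *)

Section TripleSum.
Variable R : realType.
Local Notation normc := ComplexField.Normc.normc.

Lemma qpochR_ge1 (r w : R) N : 0 <= r -> 0 <= w -> 1 <= qpoch (- w) r N.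
Proof.
move=> r0 w0; elim: N => [|N IH]; first by rewrite qpoch0.
by rewrite qpochS mulr_ege1 // mulNr opprK lerDl mulr_ge0 ?exprn_ge0.
Qed.

Lemma qpochR_ge0 (r w : R) N : 0 <= r -> 0 <= w -> 0 <= qpoch (- w) r N.
Proof. by move=> r0 w0; apply: le_trans ler01 (qpochR_ge1 N r0 w0). Qed.

Lemma theta_partial_le (r w : R) N : 0 <= r -> 0 <= w ->
  \sum_(k < N) w ^+ k * r ^+ 'C(k, 2) <= qpoch (- w) r N.
Proof.
move=> r0; elim: N w => [|N IH] w w0; first by rewrite big_ord0 qpoch0.
have wr0 : 0 <= w * r by rewrite mulr_ge0.
rewrite big_ord_recl qpochSl opprK mulNr /= !expr0 mulr1.
rewrite (eq_bigr (fun k : 'I_N => w * ((w * r) ^+ k * r ^+ 'C(k, 2))));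
  last first.
  by move=> k _; rewrite /bump /= add1n binS bin1 exprD exprS exprMn; ring.
rewrite -mulr_sumr mulrDl mul1r lerD //; last by rewrite ler_wpM2l // IH.
exact: qpochR_ge1.
Qed.

Lemma qpochR_reflect_le (r w : R) i : 0 < r <= 1 -> 0 <= w ->
  qpoch (- (w * r ^- i)) r i <= r ^- 'C(i.+1, 2) * (1 + w) ^+ i.
Proof.
move=> /andP[r0 r1] w0; elim: i => [|i IH].
  by rewrite qpoch0 bin_small // !expr0 invr1 mulr1.
rewrite qpochSl mulNr opprK.
have -> : w * r ^- i.+1 * r = w * r ^- i.
  by rewrite exprSr; field; rewrite !gt_eqF ?exprn_gt0.
rewrite binS bin1 exprD invfM (exprS (1 + w)).
have -> : r ^- 'C(i.+1, 2) * r ^- i.+1 * ((1 + w) * (1 + w) ^+ i)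
  = (r ^- i.+1 * (1 + w)) * (r ^- 'C(i.+1, 2) * (1 + w) ^+ i) by ring.
have ri : 1 <= r ^- i.+1.
  by rewrite invf_ge1 ?exprn_gt0 // exprn_ile1 // ltW.
apply: ler_pM => //.
- by rewrite addr_ge0 // mulr_ge0 // (le_trans _ ri).
- by apply: qpochR_ge0; rewrite ?mulr_ge0 ?invr_ge0 ?exprn_ge0 // ltW.
- by rewrite mulrDr mulr1 (mulrC w) lerD2r.
Qed.

Section Base.
Variable q : R[i].
Hypotheses (q_neq0 : q != 0) (q_lt1 : normc q < 1).
Let r := normc q.
Let r_gt0 : 0 < r.
Proof.
rewrite lt_neqAle normc_ge0 andbT eq_sym.
by apply: contra q_neq0 => /eqP/ComplexField.Normc.eq0_normc ->.
Qed.
Let r0 : 0 <= r := ltW r_gt0.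
Let half01 : 0 <= (1 / 2 : R) < 1. Proof. by apply/andP; split; lra. Qed.
Let qq_neq0 n : qpoch q q n != 0. Proof. exact: qpoch_neq0. Qed.

Lemma watson_lim (a rho b sigma c : R[i]) (A s : R) (T : R[i]) :
    normc a <= 1 -> rho * b = a * q -> sigma * c = a * q ->
    normc b < 1 -> normc c < 1 -> 0 <= s < 1 ->
    let alpha :=
      bailey_alpha q rho b (bailey_alpha q sigma c (unit_alpha q a)) in
    (forall k, normc (alpha k) <= A * s ^+ k) ->
    (fun n => \sum_(k < n) alpha k) @ \oo --> T ->
  (fun N => \sum_(n < N) qpoch rho q n * (- b) ^+ n * q ^+ 'C(n, 2)
              / (qpoch q q n * qpoch c q n))
    @ \oo --> qpoch_inf b q * T / qpoch_inf (a * q) q.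
Proof.
move=> a1 rb sc b1 c1 s01 alpha hA hT.
have aq1 : normc (a * q) < 1.
  apply: le_lt_trans q_lt1; rewrite ComplexField.Normc.normcM.
  by rewrite ler_piMl ?normc_ge0.
have pair := watson_pair q_neq0 qq_neq0 (fun n => qpoch_neq0 q_lt1 n aq1)
  rb (fun n => qpoch_neq0 q_lt1 n b1) sc (fun n => qpoch_neq0 q_lt1 n c1).
have [_ /(_ hT) h] := bailey_lim q_lt1 T a1 s01 hA pair.
have {}h := limM (qpoch_cvg q_lt1 (a := b)) h.
pose t n := qpoch rho q n * (- b) ^+ n * q ^+ 'C(n, 2)
              / (qpoch q q n * qpoch c q n).
have [A1 hA1] := theta_majorant q_lt1 (normc_ge0 b).
pose B1 := expR (normc rho / (1 - r)).
pose B2 := expR ((1 - r)^-1 / (1 - r)).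
pose B3 := expR ((1 - normc c)^-1 / (1 - r)).
have tA k : normc (t k) <= (B1 * (B2 * B3)) * A1 * (1 / 2) ^+ k.
  have -> : normc (t k) = normc (qpoch rho q k)
     * (normc (qpoch q q k)^-1 * normc (qpoch c q k)^-1)
     * (normc b ^+ k * r ^+ 'C(k, 2)).
    by rewrite /t invfM !ComplexField.Normc.normcM !normcX normcN; ring.
  rewrite -(mulrA _ A1).
  apply: ler_pM; rewrite ?mulr_ge0 ?exprn_ge0 ?normc_ge0 //.
  apply: ler_pM; rewrite ?mulr_ge0 ?normc_ge0 //.
    apply: le_trans (normc_qpoch_le _ _ _) _.
    by apply: qpochR_le; rewrite ?normc_ge0.
  by apply: ler_pM; rewrite ?normc_ge0 ?normc_qpochV_le.
have B4 : normc (1 : R[i]) <= Num.max 1 B2.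
  by rewrite ComplexField.Normc.normc1 le_max lexx.
have qB n : normc (qpoch q q n)^-1 <= Num.max 1 B2.
  by rewrite le_max normc_qpochV_le ?orbT.
have q_inf0 : (qpoch_inf q q)^-1 != 0 by rewrite invr_eq0 qpoch_inf_neq0.
have [+ _] := @convolution_lim _ t (fun n => (qpoch q q n)^-1) (fun=> 1) _ _ _
  _ _ (qpoch_inf b q * T / qpoch_inf (a * q) q) half01 tA qB (fun=> B4)
  (qpochV_cvg q_lt1 q_lt1) (@lim_cst _ 1) q_inf0 (oner_neq0 _).
apply.
have -> : qpoch_inf b q * T / qpoch_inf (a * q) q * ((qpoch_inf q q)^-1 * 1)
  = qpoch_inf b q * (T / (qpoch_inf q q * qpoch_inf (a * q) q)).
  by rewrite mulr1 invfM; ring.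
apply: lim_ext h => n /=; rewrite mulrC mulfVK ?qpoch_neq0 //.
by apply: eq_bigr => k _; rewrite /t invfM mulr1; ring.
Qed.

Definition triple_term (u x y : R[i]) i j k : R[i] :=
  q ^+ (i ^ 2) * u ^+ i / qpoch q q i
  * euler_term q (x * q ^+ i) j * euler_term q (y * q ^- i) k.

Lemma cube_sum_triple u x y N : cube_sum (triple_term u x y) N
  = \sum_(i < N) q ^+ (i ^ 2) * u ^+ i / qpoch q q i
    * (\sum_(j < N) euler_term q (x * q ^+ i) j)
    * (\sum_(k < N) euler_term q (y * q ^- i) k).
Proof.
apply: eq_bigr => i _; rewrite -(mulrA (_ / _)) mulr_suml mulr_sumr.
apply: eq_bigr => j _.
by rewrite !mulr_sumr; apply: eq_bigr => k _; rewrite /triple_term; ring.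
Qed.

Lemma normc_euler_sum_le : exists2 B : R, 0 <= B & forall z N,
  normc (\sum_(k < N) euler_term q z k) <= B * qpoch (- normc z) r N.
Proof.
exists (expR ((1 - r)^-1 / (1 - r))); first exact: expR_ge0.
move=> z N; apply: le_trans (normc_sum _ _) _.
apply: (@le_trans _ _ (\sum_(k < N) expR ((1 - r)^-1 / (1 - r))
    * (normc z ^+ k * r ^+ 'C(k, 2)))).
  apply: ler_sum => k _.
  rewrite /euler_term !ComplexField.Normc.normcM !normcX mulrC.
  by rewrite ler_wpM2r ?mulr_ge0 ?exprn_ge0 ?normc_ge0 ?normc_qpochV_le.
by rewrite -mulr_sumr ler_wpM2l ?expR_ge0 // theta_partial_le ?normc_ge0.
Qed.

Lemma triple_sum_lim (u x y S : R[i]) : y != 0 ->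
    (forall n, qpoch (- x) q n != 0) ->
    (fun N => \sum_(i < N) q ^+ 'C(i, 2) * (u * y) ^+ i * qpoch (- q / y) q i
               / (qpoch q q i * qpoch (- x) q i)) @ \oo --> S ->
  cube_sum (triple_term u x y) @ \oo
    --> qpoch_inf (- x) q * qpoch_inf (- y) q * S.
Proof.
move=> y0 x0 hS.
have [B B0 hB] := normc_euler_sum_le.
pose U := normc u; pose X := normc x; pose Y := normc y.
have U0 : 0 <= U by exact: normc_ge0.
have X0 : 0 <= X by exact: normc_ge0.
have Y0 : 0 <= Y by exact: normc_ge0.
have [A hA] := @theta_majorant _ _ q_lt1 (U * (1 + Y))
  (mulr_ge0 U0 (addr_ge0 ler01 Y0)).
pose f N i := q ^+ (i ^ 2) * u ^+ i / qpoch q q i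
    * (\sum_(j < N) euler_term q (x * q ^+ i) j)
    * (\sum_(k < N) euler_term q (y * q ^- i) k).
pose g i := q ^+ (i ^ 2) * u ^+ i / qpoch q q i
    * qpoch_inf (- (x * q ^+ i)) q * qpoch_inf (- (y * q ^- i)) q.
pose E := expR (X / (1 - r)); pose E' := expR (Y / (1 - r)).
pose E2 := expR ((1 - r)^-1 / (1 - r)).
have r1 : 0 < 1 - r by rewrite subr_gt0.
have bX N i : normc (\sum_(j < N) euler_term q (x * q ^+ i) j) <= B * E.
  apply: le_trans (hB _ _) _; rewrite ler_wpM2l //.
  apply: le_trans (qpochR_le q_lt1 _ (normc_ge0 _)) _.
  rewrite ler_expR ler_pM2r ?invr_gt0 // ComplexField.Normc.normcM normcX.
  by rewrite ler_piMr // exprn_ile1 // ltW.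
have bY N i : normc (\sum_(k < N) euler_term q (y * q ^- i) k)
    <= B * (r ^- 'C(i.+1, 2) * (1 + Y) ^+ i * E').
  apply: le_trans (hB _ _) _; rewrite ler_wpM2l //.
  have -> : normc (y * q ^- i) = Y * r ^- i.
    by rewrite ComplexField.Normc.normcM ComplexField.Normc.normcV normcX.
  have w0 : 0 <= Y * r ^- i by rewrite mulr_ge0 // invr_ge0 exprn_ge0.
  apply: (@le_trans _ _ (qpoch (- (Y * r ^- i)) r (N + i))).
    rewrite qpochD ler_peMr ?qpochR_ge0 // mulNr qpochR_ge1 //.
    by rewrite mulr_ge0 ?exprn_ge0.
  rewrite addnC qpochD; apply: ler_pM.
  - exact: qpochR_ge0.
  - by rewrite mulNr qpochR_ge0 // mulr_ge0 ?exprn_ge0.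
  - by apply: qpochR_reflect_le => //; rewrite r_gt0 ltW.
  - rewrite mulNr mulfVK ?expf_neq0 ?gt_eqF //; exact: qpochR_le.
have fA N i : normc (f N i) <= E2 * (B * E) * (B * E') * A * (1 / 2) ^+ i.
  apply: (@le_trans _ _ (r ^+ (i ^ 2) * U ^+ i * E2 * (B * E)
     * (B * (r ^- 'C(i.+1, 2) * (1 + Y) ^+ i * E')))).
    rewrite /f ComplexField.Normc.normcM.
    apply: ler_pM; rewrite ?normc_ge0 ?bY //.
    rewrite ComplexField.Normc.normcM.
    apply: ler_pM; rewrite ?normc_ge0 ?bX //.
    rewrite !ComplexField.Normc.normcM !normcX.
    by rewrite ler_wpM2l ?mulr_ge0 ?exprn_ge0 ?normc_qpochV_le.
  have -> : r ^+ (i ^ 2) = r ^+ 'C(i, 2) * r ^+ 'C(i.+1, 2).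
    by rewrite -exprD -sqrn_bin2.
  have -> : r ^+ 'C(i, 2) * r ^+ 'C(i.+1, 2) * U ^+ i * E2 * (B * E)
     * (B * (r ^- 'C(i.+1, 2) * (1 + Y) ^+ i * E'))
   = E2 * (B * E) * (B * E') * ((U * (1 + Y)) ^+ i * r ^+ 'C(i, 2)).
    by rewrite exprMn; field; rewrite gt_eqF ?exprn_gt0.
  rewrite -(mulrA _ A) ler_wpM2l //.
  by rewrite !mulr_ge0 ?expR_ge0.
have fg i : f ^~ i @ \oo --> g i.
  apply: limM; last exact: euler_cvg.
  by apply: limM; [exact: lim_cst|exact: euler_cvg].
have [_ h] := tannery_lim (qpoch_inf (- x) q * qpoch_inf (- y) q * S)
  half01 fA fg.
have -> : cube_sum (triple_term u x y) = (fun N => \sum_(i < N) f N i).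
  by apply/funext => N; rewrite cube_sum_triple.
apply: h.
apply: lim_ext (limM (@lim_cst _ (qpoch_inf (- x) q * qpoch_inf (- y) q)) hS).
move=> N /=; rewrite mulr_sumr; apply: eq_bigr => i _.
rewrite /g (qpoch_infD q_lt1 (- x) i) mulNr.
have -> : qpoch_inf (- (y * q ^- i)) q
    = y ^+ i * q ^- 'C(i.+1, 2) * qpoch (- q / y) q i * qpoch_inf (- y) q.
  rewrite (qpoch_infD q_lt1 _ i) -(mulNr y) (mulfVK (expf_neq0 i q_neq0)).
  by rewrite qpoch_reflect ?oppr_eq0 // opprK invrN mulrN mulNr.
have -> : q ^+ (i ^ 2) = q ^+ 'C(i, 2) * q ^+ 'C(i.+1, 2).
  by rewrite -exprD -sqrn_bin2.
by rewrite exprMn; field; rewrite !expf_neq0 ?x0 ?qq_neq0.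
Qed.
End Base.
End TripleSum.

(** * Theta series *)

Section ThetaAndProducts.
Variable R : realType.
Local Notation normc := ComplexField.Normc.normc.
Variable q : R[i].
Hypotheses (q_neq0 : q != 0) (q_lt1 : normc q < 1).
Let r := normc q.
Let r0 : 0 <= r. Proof. exact: normc_ge0. Qed.

Lemma normc_expr_lt1 n : (0 < n)%N -> normc (q ^+ n) < 1.
Proof. by move=> n0; rewrite normcX exprn_ilt1 // -lt0n. Qed.

Lemma normc_expr_le1 n : normc (q ^+ n) <= 1.
Proof. by rewrite normcX exprn_ile1 // ltW. Qed.

Lemma qpoch_inf_split2 a :
  qpoch_inf a q = qpoch_inf a (q ^+ 2) * qpoch_inf (a * q) (q ^+ 2).
Proof.
have q2 := normc_expr_lt1 (isT : (0 < 2)%N).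
apply: (lim_unique (u := fun n => qpoch a q (n + n))).
  by apply: lim_subseq (qpoch_cvg q_lt1 (a := a)) => n; exact: leq_addr.
apply: lim_ext (limM (qpoch_cvg q2 (a := a)) (qpoch_cvg q2 (a := a * q))).
elim=> [|n IH]; first by rewrite !qpoch0 mulr1.
rewrite addSn addnS !qpochS -IH -exprM mul2n -addnn (exprS q (n + n)).
by ring.
Qed.

Lemma qpoch_inf_split3 a : qpoch_inf a q
  = qpoch_inf a (q ^+ 3) * qpoch_inf (a * q) (q ^+ 3)
    * qpoch_inf (a * q ^+ 2) (q ^+ 3).
Proof.
have q3 := normc_expr_lt1 (isT : (0 < 3)%N).
apply: (lim_unique (u := fun n => qpoch a q (3 * n))).
  by apply: lim_subseq (qpoch_cvg q_lt1 (a := a)) => n; rewrite leq_pmull.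
apply: lim_ext (limM (limM (qpoch_cvg q3 (a := a)) (qpoch_cvg q3 (a := a * q)))
  (qpoch_cvg q3 (a := a * q ^+ 2))).
elim=> [|n IH]; first by rewrite !qpoch0 !mulr1.
rewrite mulnS !addSn add0n !qpochS -IH -exprM.
rewrite (exprS q (3 * n).+1) (exprS q (3 * n)).
by ring.
Qed.

Lemma qpoch_inf_sqr a :
  qpoch_inf a q * qpoch_inf (- a) q = qpoch_inf (a ^+ 2) (q ^+ 2).
Proof.
have q2 := normc_expr_lt1 (isT : (0 < 2)%N).
apply: (lim_unique (u := fun n => qpoch a q n * qpoch (- a) q n)).
  exact: limM (qpoch_cvg q_lt1 (a := a)) (qpoch_cvg q_lt1 (a := - a)).
apply: lim_ext (qpoch_cvg q2 (a := a ^+ 2)).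
elim=> [|n IH]; first by rewrite !qpoch0 mulr1.
by rewrite !qpochS IH -exprM mulnC exprM; ring.
Qed.

Lemma triple_product_lim z A s : z != 0 -> normc z < 1 -> normc (q / z) < 1 ->
    0 <= s < 1 ->
    let v k := (-1) ^+ k * q ^+ 'C(k.+1, 2) * z ^- k * (1 - z ^+ (k + k).+1) in
    (forall k, normc (v k) <= A * s ^+ k) ->
  (fun n => \sum_(k < n) v k) @ \oo
    --> qpoch_inf z q * qpoch_inf (q / z) q * qpoch_inf q q.
Proof.
move=> z0 z1 qz1 s01 v vA.
have qq n : qpoch q q n != 0 by exact: qpoch_neq0.
have q1 : 1 - q != 0 by have := qq 1%N; rewrite /qpoch big_ord1 mulr1.
have pair := triple_product_pair q_neq0 qq z0.
set L := qpoch_inf z q * qpoch_inf (q / z) q * qpoch_inf q q.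
have vA' k : normc (v k / (1 - q)) <= A * normc (1 - q)^-1 * s ^+ k.
  by rewrite ComplexField.Normc.normcM mulrAC ler_wpM2r ?normc_ge0.
have [h _] := bailey_lim q_lt1 (L / (1 - q)) (ltW q_lt1) s01 vA' pair.
have qqE : qpoch_inf q q = (1 - q) * qpoch_inf (q * q) q.
  by rewrite (qpoch_infD q_lt1 q 1) expr1 /qpoch big_ord1 mulr1.
have qq_inf := qpoch_inf_neq0 q_lt1 q_lt1.
have q2_inf : qpoch_inf (q * q) q != 0.
  by move: qq_inf; rewrite qqE mulf_eq0 negb_or => /andP[].
have {}h : (fun n => \sum_(k < n) v k / (1 - q)) @ \oo --> L / (1 - q).
  apply: h.
  have -> : L / (1 - q) / (qpoch_inf q q * qpoch_inf (q * q) q)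
     = qpoch_inf z q * qpoch_inf (q / z) q / qpoch_inf q q.
    rewrite /L qqE; move: q2_inf; generalize (qpoch_inf (q * q) q) => t t0.
    generalize (qpoch_inf z q) (qpoch_inf (q / z) q) => a b.
    by field; rewrite t0 q1.
  have zS := @lim_subseq _ _ _ S leqnSn (@qpoch_cvg _ _ q_lt1 z).
  have qS : (fun n => (qpoch q q (n + n).+1)^-1) @ \oo --> (qpoch_inf q q)^-1.
    apply: (@lim_subseq _ (fun n => (qpoch q q n)^-1) _ (fun n => (n + n).+1)).
      by move=> n; rewrite ltnW // ltnS leq_addr.
    exact: qpochV_cvg.
  exact: limM (limM zS (@qpoch_cvg _ _ q_lt1 (q / z))) qS.
have := limM h (@lim_cst _ (1 - q)); rewrite (divfK q1).
by apply: lim_ext => n; rewrite -mulr_suml (divfK q1).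
Qed.
End ThetaAndProducts.

Section Slater.
Variable R : realType.
Local Notation normc := ComplexField.Normc.normc.
Variable q : R[i].
Hypotheses (q_neq0 : q != 0) (q_lt1 : normc q < 1).
Let r := normc q.
Let r0 : 0 <= r. Proof. exact: normc_ge0. Qed.
Let r01 : 0 <= r < 1. Proof. by rewrite r0. Qed.
Let q3_lt1 : normc (q ^+ 3) < 1. Proof. exact: normc_expr_lt1. Qed.
Let q5_lt1 : normc (q ^+ 5) < 1. Proof. exact: normc_expr_lt1. Qed.
Let q6_lt1 : normc (q ^+ 6) < 1. Proof. exact: normc_expr_lt1. Qed.

Let p_lt1 : normc (q ^+ 2) < 1. Proof. exact: normc_expr_lt1. Qed.

Lemma normc_2expr (w z : R[i]) m k :
    (k <= m)%N -> normc w = 1 -> normc z <= 2 ->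
  normc (w * q ^+ m * z) <= 2 * r ^+ k.
Proof.
move=> km w1 z2; rewrite !ComplexField.Normc.normcM normcX w1 mul1r mulrC.
apply: ler_pM; rewrite ?normc_ge0 ?exprn_ge0 //.
by rewrite ler_wiXn2l // ltW.
Qed.

Lemma normc_sign k : normc ((-1) ^+ k : R[i]) = 1.
Proof. by rewrite normcX normcN ComplexField.Normc.normc1 expr1n. Qed.

Lemma normc_1B_le2 m : normc (1 - q ^+ m) <= 2.
Proof.
apply: le_trans (normcD _ _) _; rewrite normcN ComplexField.Normc.normc1.
by rewrite -[leRHS]/(1 + 1) lerD2l normc_expr_le1.
Qed.

Definition theta1 k : R[i] :=
  if k is 0 then 1 else (-1) ^+ k * q ^+ (3 * k ^ 2) * 2.

Definition theta2 k : R[i] :=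
  (-1) ^+ k * q ^+ (3 * k ^ 2 + 2 * k) * (1 - q ^+ (k + k).+1).

Lemma theta1_le k : normc (theta1 k) <= 2 * r ^+ k.
Proof.
case: k => [|k].
  by rewrite ComplexField.Normc.normc1 expr0 mulr1 ler1n.
apply: normc_2expr; rewrite ?normc_sign //; first by nia.
have -> : (2 : R[i]) = 1 + 1 by ring.
by apply: le_trans (normcD _ _) _; rewrite ComplexField.Normc.normc1.
Qed.

Lemma theta2_le k : normc (theta2 k) <= 2 * r ^+ k.
Proof. by apply: normc_2expr; rewrite ?normc_sign ?normc_1B_le2 //; nia. Qed.

Lemma theta2_cvg : (fun n => \sum_(k < n) theta2 k) @ \oo
  --> qpoch_inf q (q ^+ 6) * qpoch_inf (q ^+ 5) (q ^+ 6)
      * qpoch_inf (q ^+ 6) (q ^+ 6).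
Proof.
have E k : (-1) ^+ k * (q ^+ 6) ^+ 'C(k.+1, 2) * q ^- k * (1 - q ^+ (k + k).+1)
    = theta2 k.
  rewrite /theta2 -exprM; congr (_ * _); rewrite -mulrA; congr (_ * _).
  apply: (mulIf (expf_neq0 k q_neq0)); rewrite mulfVK ?expf_neq0 // -exprD.
  by congr (_ ^+ _); have := bin2_sqr k.+1; nia.
have := @triple_product_lim R (q ^+ 6) (expf_neq0 6 q_neq0) q6_lt1
  q 2 r q_neq0 q_lt1.
have -> : q ^+ 6 / q = q ^+ 5 by rewrite exprSr mulfK.
move=> /(_ q5_lt1 r01) h.
apply: lim_ext (h _) => [n|k]; first by apply: eq_bigr => k _; exact: E.
by rewrite E theta2_le.
Qed.

Lemma theta1_cvg : (fun n => \sum_(k < n) theta1 k) @ \oo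
  --> qpoch_inf (q ^+ 3) (q ^+ 6) ^+ 2 * qpoch_inf (q ^+ 6) (q ^+ 6).
Proof.
pose w k : R[i] := (-1) ^+ k * q ^+ (3 * k ^ 2).
have E k : (-1) ^+ k * (q ^+ 6) ^+ 'C(k.+1, 2) * (q ^+ 3) ^- k
    * (1 - (q ^+ 3) ^+ (k + k).+1)
    = (-1) ^+ k * q ^+ (3 * k ^ 2) * (1 - (q ^+ 3) ^+ (k + k).+1).
  rewrite -!exprM; congr (_ * _); rewrite -mulrA; congr (_ * _).
  apply: (mulIf (expf_neq0 (3 * k) q_neq0)).
  rewrite mulfVK ?expf_neq0 // -exprD.
  by congr (_ ^+ _); have := bin2_sqr k.+1; nia.
have E' k : (-1) ^+ k * q ^+ (3 * k ^ 2) * (1 - (q ^+ 3) ^+ (k + k).+1)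
    = w k + w k.+1.
  rewrite /w (exprS (-1)) mulrBr mulr1 mulN1r mulNr -mulrA -exprM -exprD.
  by congr (_ - _ * _ ^+ _); nia.
have := @triple_product_lim R (q ^+ 6) (expf_neq0 6 q_neq0) q6_lt1
  (q ^+ 3) 2 r (expf_neq0 3 q_neq0) q3_lt1.
have -> : q ^+ 6 / q ^+ 3 = q ^+ 3.
  by rewrite (exprD q 3 3) mulfK // expf_neq0.
move=> /(_ q3_lt1 r01) h.
have w0 : w @ \oo --> 0.
  apply/lim_normcP => e e0.
  have [N hN] := expr_lt_eps r01 e0; exists N => n Nn; rewrite sub0r normcN.
  apply: le_lt_trans (hN _ Nn); rewrite /w ComplexField.Normc.normcM normc_sign.
  by rewrite mul1r normcX ler_wiXn2l ?(ltW q_lt1) //; nia.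
apply: lim_shift.
have h1 : (fun n => \sum_(k < n) (w k + w k.+1)) @ \oo
   --> qpoch_inf (q ^+ 3) (q ^+ 6) ^+ 2 * qpoch_inf (q ^+ 6) (q ^+ 6).
  rewrite expr2; apply: lim_ext (h _) => [n|k].
    by apply: eq_bigr => k _; rewrite E E'.
  rewrite E; apply: normc_2expr; rewrite ?normc_sign //; first by nia.
  by rewrite -exprM normc_1B_le2.
have := limD h1 w0; rewrite addr0; apply: lim_ext.
elim=> [|n IH].
  by rewrite big_ord0 big_ord1 add0r /w /= !expr0 mulr1.
rewrite big_ord_recr [RHS]big_ord_recr /= -IH.
by rewrite /theta1 -/(w n.+1); ring.
Qed.

Local Notation p := (q ^+ 2).
Let p_neq0 : p != 0. Proof. exact: expf_neq0. Qed.
Let qNp n : qpoch (- q) p n != 0.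
Proof. by apply: qpoch_neq0 => //; rewrite normcN. Qed.
Let pNp n : qpoch (- p) p n != 0.
Proof. by apply: qpoch_neq0 => //; rewrite normcN. Qed.
Let ppn n : qpoch p p n != 0. Proof. exact: qpoch_neq0. Qed.

Lemma expr_theta k :
  p ^+ 'C(k, 2) * p ^+ 'C(k, 2) * p ^+ 'C(k, 2) * q ^+ (3 * k)
  = q ^+ (3 * k ^ 2).
Proof.
by rewrite -!exprM -!exprD; congr (_ ^+ _); have := bin2_sqr k; nia.
Qed.

Lemma theta1_alpha k :
  qpoch (-1) p k / qpoch (- p) p k * (p * q) ^+ k
    * p ^+ 'C(k, 2) * p ^+ 'C(k, 2) * unit_alpha p 1 k = theta1 k.
Proof.
case: k => [|k]; first by rewrite !qpoch0 bin_small // !expr0 divr1 !mulr1.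
rewrite /theta1 -expr_theta /unit_alpha !mul1r (qpochSl p (-1)) mulN1r.
rewrite (qpochS p (- p)) (qpochS p p) -!exprS mulNr -exprS !opprK.
have := ppn k.+1; rewrite qpochS -exprS mulf_eq0 negb_or => /andP[pk pk1].
have := pNp k.+1; rewrite qpochS mulNr opprK -exprS mulf_eq0 negb_or.
move=> /andP[nk nk1].
have -> : p * q = q ^+ 3 by rewrite -exprSr.
by rewrite -(exprM q 3) (exprD p k.+1 k.+1); field; rewrite pk pk1 nk nk1.
Qed.

Lemma theta2_alpha k :
  qpoch (- q) p k / qpoch (- q ^+ 3) p k * (q ^+ 3 * p) ^+ k
    * p ^+ 'C(k, 2) * p ^+ 'C(k, 2) * unit_alpha p p k
  = (1 + q) / (1 - p) * theta2 k.
Proof.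
have p1 : 1 - p != 0 by have := ppn 1; rewrite /qpoch big_ord1 mulr1.
have q1 : 1 + q != 0 by have := qNp 1; rewrite /qpoch big_ord1 mulr1 opprK.
have q3k : qpoch (- q ^+ 3) p k != 0.
  by apply: qpoch_neq0 => //; rewrite normcN; exact: normc_expr_lt1.
have qk : 1 + q ^+ (k + k).+1 != 0.
  have := qNp k.+1; rewrite qpochS -exprM mulNr opprK -exprS mul2n addnn.
  by rewrite mulf_eq0 negb_or => /andP[].
have ratio : qpoch (- q) p k / qpoch (- q ^+ 3) p k
    = (1 + q) / (1 + q ^+ (k + k).+1).
  have := qpochSl p (- q) k; rewrite qpochS -exprM !mulNr !opprK -exprS -exprS.
  rewrite mul2n addnn => e; apply/eqP.
  rewrite eqr_div //; last by rewrite -addnn.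
  by rewrite -addnn in e *; rewrite e.
have -> : unit_alpha p p k
    = (-1) ^+ k * p ^+ 'C(k, 2) * (1 - p ^+ (k + k).+1) / (1 - p).
  case: k {q3k qk ratio} => [|k].
    by rewrite /= !expr0 expr1 !mul1r divff.
  rewrite /unit_alpha (qpochSl p p) -exprS; field.
  by rewrite p1 (qpoch_neq0 p_lt1) // -exprD normc_expr_lt1.
rewrite ratio /theta2 exprD -expr_theta.
have -> : q ^+ 3 * p = q ^+ 5 by rewrite -exprD.
have -> : (q ^+ 5) ^+ k = q ^+ (3 * k) * q ^+ (2 * k).
  by rewrite -exprM -exprD -mulnDl.
have -> : p ^+ (k + k).+1 = q ^+ (k + k).+1 * q ^+ (k + k).+1.
  by rewrite -exprM -exprD mul2n -addnn.
by field; rewrite qk p1.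
Qed.
End Slater.

(** * The triple sums for nonzero q *)

Section TripleSums.
Variable R : realType.
Local Notation normc := ComplexField.Normc.normc.
Variable q : R[i].
Hypotheses (q_neq0 : q != 0) (q_lt1 : normc q < 1).
Let r := normc q.
Let r01 : 0 <= r < 1. Proof. by rewrite normc_ge0. Qed.
Let q3_lt1 : normc (q ^+ 3) < 1. Proof. exact: normc_expr_lt1. Qed.
Local Notation p := (q ^+ 2).
Let p_lt1 : normc p < 1. Proof. exact: normc_expr_lt1. Qed.
Let p_neq0 : p != 0. Proof. exact: expf_neq0. Qed.

Let p_div_q : p / q = q. Proof. by rewrite exprSr expr1 mulfK. Qed.

Lemma triple_watson_lim (a x y sigma : R[i]) (t : nat -> R[i]) (A s : R)
    (T : R[i]) :
    y != 0 -> normc a <= 1 -> sigma * - x = a * p ->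
    normc (a * y) < 1 -> normc x < 1 -> 0 <= s < 1 ->
    (forall k, qpoch (- p / y) p k / qpoch (- (a * y)) p k * (a * y) ^+ k
      * p ^+ 'C(k, 2) * (qpoch sigma p k / qpoch (- x) p k * x ^+ k
      * p ^+ 'C(k, 2) * unit_alpha p a k) = t k) ->
    (forall k, normc (t k) <= A * s ^+ k) ->
    (fun n => \sum_(k < n) t k) @ \oo --> T ->
  cube_sum (triple_term p a x y) @ \oo --> qpoch_inf (- x) p * qpoch_inf (- y) p
     * (qpoch_inf (- (a * y)) p * T / qpoch_inf (a * p) p).
Proof.
move=> y0 a1 sx ay1 x1 s01 tE tA tT.
have rb : - p / y * - (a * y) = a * p by field.
have alphaE k : bailey_alpha p (- p / y) (- (a * y))
    (bailey_alpha p sigma (- x) (unit_alpha p a)) k = t k.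
  by rewrite /bailey_alpha !opprK tE.
have x0 n : qpoch (- x) p n != 0 by apply: qpoch_neq0 => //; rewrite normcN.
have ay1' : normc (- (a * y)) < 1 by rewrite normcN.
have x1' : normc (- x) < 1 by rewrite normcN.
have h := watson_lim p_neq0 p_lt1 a1 rb sx ay1' x1' s01 (A := A) (T := T).
apply: (triple_sum_lim p_neq0 p_lt1 y0 x0).
apply: lim_ext (h _ _) => [N|k|].
- by apply: eq_bigr => n _; rewrite opprK; ring.
- by rewrite alphaE.
- by apply: lim_ext tT => n; apply: eq_bigr => k _; rewrite alphaE.
Qed.

Lemma J_neq0 m : (0 < m)%N -> J q m != 0.
Proof. by move=> m0; rewrite qpoch_inf_neq0 ?normc_expr_lt1. Qed.

Lemma qpoch_inf_odd : qpoch_inf q p = J q 1 / J q 2.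
Proof.
by rewrite /J expr1 (qpoch_inf_split2 q_lt1 q) -expr2 mulfK // J_neq0.
Qed.

Lemma qpoch_infN_even : qpoch_inf (- p) p = J q 4 / J q 2.
Proof.
rewrite /J (exprM q 2 2) -qpoch_inf_sqr // mulrC mulKf //; exact: J_neq0.
Qed.

Lemma qpoch_infN_odd : qpoch_inf (- q) p = J q 2 ^+ 2 / (J q 1 * J q 4).
Proof.
have e1 := qpoch_inf_sqr p_lt1 q.
have := qpoch_inf_split2 p_lt1 p; rewrite -expr2 -e1 -exprM qpoch_inf_odd.
rewrite -/(J q 2) -/(J q 4) => e2.
have J1 := J_neq0 (isT : 0 < 1)%N; have J2 := J_neq0 (isT : 0 < 2)%N.
have J4 := J_neq0 (isT : 0 < 4)%N.
move: J1 J2 J4 e2; generalize (J q 1) (J q 2) (J q 4) (qpoch_inf (- q) p).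
move=> j1 j2 j4 w j1_0 j2_0 j4_0 e.
have -> : j2 ^+ 2 = j1 * w * j4 by rewrite expr2 {1}e; field.
by field; rewrite j1_0 j4_0.
Qed.

Lemma qpoch_inf_3_6 : qpoch_inf (q ^+ 3) (q ^+ 6) = J q 3 / J q 6.
Proof.
rewrite [J q 3]/J (qpoch_inf_split2 q3_lt1) -expr2 -exprM mulfK //.
exact: (J_neq0 (isT : 0 < 6)%N).
Qed.

Lemma qpoch_inf_1_5_6 : qpoch_inf q (q ^+ 6) * qpoch_inf (q ^+ 5) (q ^+ 6)
  = J q 1 * J q 6 / (J q 2 * J q 3).
Proof.
have J2 := J_neq0 (isT : 0 < 2)%N; have J3 := J_neq0 (isT : 0 < 3)%N.
have J6 := J_neq0 (isT : 0 < 6)%N.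
have e : J q 1 / J q 2 = qpoch_inf q (q ^+ 6) * qpoch_inf (q ^+ 3) (q ^+ 6)
    * qpoch_inf (q ^+ 5) (q ^+ 6).
  have p3 : p ^+ 3 = q ^+ 6 by rewrite -exprM.
  have qp : q * p = q ^+ 3 by rewrite -exprS.
  have qp2 : q * p ^+ 2 = q ^+ 5 by rewrite -exprM -exprS.
  have := qpoch_inf_split3 p_lt1 q; rewrite p3 qp qp2 => <-.
  by rewrite qpoch_inf_odd.
rewrite qpoch_inf_3_6 in e.
move: J2 J3 J6 e; generalize (J q 1) (J q 2) (J q 3) (J q 6).
generalize (qpoch_inf q (q ^+ 6)) (qpoch_inf (q ^+ 5) (q ^+ 6)).
move=> v w j1 j2 j3 j6 j2_0 j3_0 j6_0 e.
transitivity ((j1 / j2) * (j6 / j3)); last by field; rewrite j2_0 j3_0.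
by rewrite e; field; rewrite j3_0 j6_0.
Qed.

Let J1 := J_neq0 (isT : 0 < 1)%N.
Let J2 := J_neq0 (isT : 0 < 2)%N.
Let J3 := J_neq0 (isT : 0 < 3)%N.
Let J4 := J_neq0 (isT : 0 < 4)%N.
Let J6 := J_neq0 (isT : 0 < 6)%N.

Lemma triple_sum2 : cube_sum (triple_term p 1 q p) @ \oo
  --> J q 3 ^+ 2 * J q 4 / (J q 1 * J q 2 * J q 6).
Proof.
have h := @triple_watson_lim 1 q p (- q) (theta1 q) 2 r _ p_neq0.
have -> : J q 3 ^+ 2 * J q 4 / (J q 1 * J q 2 * J q 6)
  = qpoch_inf (- q) p * qpoch_inf (- p) p
    * (qpoch_inf (- (1 * p)) p
       * (qpoch_inf (q ^+ 3) (q ^+ 6) ^+ 2 * qpoch_inf (q ^+ 6) (q ^+ 6))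
       / qpoch_inf (1 * p) p).
  rewrite !mul1r qpoch_infN_odd qpoch_infN_even qpoch_inf_3_6.
  rewrite -/(J q 6) -/(J q 2); move: J1 J2 J4 J6.
  generalize (J q 1) (J q 2) (J q 3) (J q 4) (J q 6) => j1 j2 j3 j4 j6.
  by move=> j1_0 j2_0 j4_0 j6_0; field; rewrite j1_0 j2_0 j4_0 j6_0.
apply: h.
- by rewrite ComplexField.Normc.normc1.
- by ring.
- by rewrite mul1r.
- by [].
- by [].
- move=> k; rewrite mul1r mulNr divff //.
  rewrite divff ?(qpoch_neq0 p_lt1) ?normcN // -(theta1_alpha q_neq0 q_lt1).
  by rewrite (exprMn k p q); ring.
- by move=> k; apply: theta1_le.
- by apply: theta1_cvg.
Qed.

Lemma triple_sum3 : cube_sum (triple_term p 1 p q) @ \oo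
  --> J q 2 ^+ 2 * J q 3 ^+ 2 / (J q 1 ^+ 2 * J q 4 * J q 6).
Proof.
have h := @triple_watson_lim 1 p q (- 1) (theta1 q) 2 r _ q_neq0.
have -> : J q 2 ^+ 2 * J q 3 ^+ 2 / (J q 1 ^+ 2 * J q 4 * J q 6)
  = qpoch_inf (- p) p * qpoch_inf (- q) p
    * (qpoch_inf (- (1 * q)) p
       * (qpoch_inf (q ^+ 3) (q ^+ 6) ^+ 2 * qpoch_inf (q ^+ 6) (q ^+ 6))
       / qpoch_inf (1 * p) p).
  rewrite !mul1r qpoch_infN_odd qpoch_infN_even qpoch_inf_3_6.
  rewrite -/(J q 6) -/(J q 2); move: J1 J2 J4 J6.
  generalize (J q 1) (J q 2) (J q 3) (J q 4) (J q 6) => j1 j2 j3 j4 j6.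
  by move=> j1_0 j2_0 j4_0 j6_0; field; rewrite j1_0 j2_0 j4_0 j6_0.
apply: h.
- by rewrite ComplexField.Normc.normc1.
- by ring.
- by rewrite mul1r.
- by [].
- by [].
- move=> k; rewrite mul1r mulNr p_div_q.
  rewrite divff ?(qpoch_neq0 p_lt1) ?normcN // -(theta1_alpha q_neq0 q_lt1).
  by rewrite (exprMn k p q); ring.
- by move=> k; apply: theta1_le.
- by apply: theta1_cvg.
Qed.

Let p1 : 1 - p != 0.
Proof. by have := qpoch_neq0 p_lt1 1 p_lt1; rewrite /qpoch big_ord1 mulr1. Qed.
Let q1 : 1 + q != 0.
Proof.
have qN : normc (- q) < 1 by rewrite normcN.
by have := qpoch_neq0 p_lt1 1 qN; rewrite /qpoch big_ord1 mulr1 opprK.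
Qed.

Lemma qpoch_infN_3_2 : qpoch_inf (- q ^+ 3) p = qpoch_inf (- q) p / (1 + q).
Proof.
rewrite (qpoch_infD p_lt1 (- q) 1) /qpoch big_ord1 expr0 mulr1 opprK expr1.
by rewrite mulrAC divff // mul1r mulNr -exprS.
Qed.

Lemma qpoch_inf_4_2 : qpoch_inf (p * p) p = J q 2 / (1 - p).
Proof.
rewrite [J q 2](qpoch_infD p_lt1 p 1) /qpoch big_ord1 expr0 mulr1 expr1.
by rewrite [RHS]mulrAC divff // mul1r.
Qed.

Lemma theta2_scaled_le c k : normc (c * theta2 q k) <= normc c * 2 * r ^+ k.
Proof.
rewrite ComplexField.Normc.normcM -mulrA ler_wpM2l ?normc_ge0 //.
exact: theta2_le.
Qed.

Lemma theta2_scaled_cvg (c : R[i]) :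
  (fun n => \sum_(k < n) c * theta2 q k) @ \oo
  --> c * (J q 1 * J q 6 / (J q 2 * J q 3) * J q 6).
Proof.
rewrite -qpoch_inf_1_5_6.
apply: lim_ext (limM (@lim_cst _ c) (theta2_cvg q_neq0 q_lt1)) => n.
exact: mulr_sumr.
Qed.

Lemma triple_sum4 : cube_sum (triple_term p p p q) @ \oo
  --> J q 2 * J q 6 ^+ 2 / (J q 1 * J q 3 * J q 4).
Proof.
pose c := (1 + q) / (1 - p).
have h := @triple_watson_lim p p q (- p) (fun k => c * theta2 q k)
  (normc c * 2) r _ q_neq0.
have pq : p * q = q ^+ 3 by rewrite -exprSr.
have -> : J q 2 * J q 6 ^+ 2 / (J q 1 * J q 3 * J q 4)
  = qpoch_inf (- p) p * qpoch_inf (- q) p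
    * (qpoch_inf (- (p * q)) p * (c * (J q 1 * J q 6 / (J q 2 * J q 3) * J q 6))
       / qpoch_inf (p * p) p).
  rewrite pq qpoch_infN_3_2 qpoch_inf_4_2 qpoch_infN_odd qpoch_infN_even /c.
  move: J1 J2 J3 J4.
  generalize (J q 1) (J q 2) (J q 3) (J q 4) (J q 6) => j1 j2 j3 j4 j6.
  move=> j1_0 j2_0 j3_0 j4_0; field.
  by rewrite j1_0 j2_0 j3_0 j4_0 p1 q1.
apply: h.
- exact: ltW.
- by ring.
- by rewrite pq.
- by [].
- by [].
- move=> k; rewrite -(theta2_alpha q_neq0 q_lt1) pq mulNr p_div_q.
  by rewrite divff ?(qpoch_neq0 p_lt1) ?normcN // (exprMn k (q ^+ 3) p); ring.
- by move=> k; apply: theta2_scaled_le.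
- by apply: theta2_scaled_cvg.
Qed.

Lemma triple_sum5 : cube_sum (triple_term p p (q ^+ 3) 1) @ \oo
  --> 2 * (J q 4 * J q 6 ^+ 2 / (J q 2 ^+ 2 * J q 3)).
Proof.
pose c := (1 + q) / (1 - p).
have h := @triple_watson_lim p (q ^+ 3) 1 (- q) (fun k => c * theta2 q k)
  (normc c * 2) r _ (oner_neq0 _).
have N1 : qpoch_inf (- 1) p = 2 * qpoch_inf (- p) p.
  rewrite (qpoch_infD p_lt1 (- 1) 1) /qpoch big_ord1 expr0 mulr1 opprK expr1.
  by rewrite mulN1r.
have -> : 2 * (J q 4 * J q 6 ^+ 2 / (J q 2 ^+ 2 * J q 3))
  = qpoch_inf (- q ^+ 3) p * qpoch_inf (- 1) p
    * (qpoch_inf (- (p * 1)) p * (c * (J q 1 * J q 6 / (J q 2 * J q 3) * J q 6))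
       / qpoch_inf (p * p) p).
  rewrite mulr1 N1 qpoch_infN_3_2 qpoch_inf_4_2 qpoch_infN_odd.
  rewrite qpoch_infN_even /c.
  move: J1 J2 J3 J4.
  generalize (J q 1) (J q 2) (J q 3) (J q 4) (J q 6) => j1 j2 j3 j4 j6.
  move=> j1_0 j2_0 j3_0 j4_0; field.
  by rewrite j1_0 j2_0 j3_0 j4_0 p1 q1.
apply: h.
- exact: ltW.
- by ring.
- by rewrite mulr1.
- by [].
- by [].
- move=> k; rewrite -(theta2_alpha q_neq0 q_lt1) mulr1 divr1.
  by rewrite divff ?(qpoch_neq0 p_lt1) ?normcN // (exprMn k (q ^+ 3) p); ring.
- by move=> k; apply: theta2_scaled_le.
- by apply: theta2_scaled_cvg.
Qed.

Lemma triple_sum1 : cube_sum (triple_term q 1 1 1) @ \oo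
  --> 6 * (J q 2 ^+ 3 / J q 1 ^+ 3).
Proof.
have qN n : qpoch (- q) q n != 0 by apply: qpoch_neq0 => //; rewrite normcN.
have two0 : (2 : R[i]) != 0 by rewrite pnatr_eq0.
have Nq : qpoch_inf (- q) q = J q 2 / J q 1.
  by rewrite /J expr1 -(qpoch_inf_sqr q_lt1 q) [RHS]mulrAC divff ?mul1r.
have N1 : qpoch_inf (- 1) q = 2 * qpoch_inf (- q) q.
  rewrite (qpoch_infD q_lt1 (- 1) 1) /qpoch big_ord1 expr0 mulr1 opprK expr1.
  by rewrite mulN1r.
have h := @triple_sum_lim R q q_neq0 q_lt1 1 1 1
  (2^-1 * (qpoch_inf (- 1) q + qpoch_inf (- q) q)) (oner_neq0 _).
have -> : 6 * (J q 2 ^+ 3 / J q 1 ^+ 3) = qpoch_inf (- 1) q * qpoch_inf (- 1) q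
   * (2^-1 * (qpoch_inf (- 1) q + qpoch_inf (- q) q)).
  rewrite N1 Nq; move: J1; generalize (J q 1) (J q 2) => j1 j2 j1_0.
  by field; rewrite j1_0.
have qN1 n : qpoch (- 1) q n.+1 = 2 * qpoch (- q) q n.
  by rewrite qpochSl mulN1r opprK.
apply: h => [[|n]|]; first by rewrite qpoch0 oner_neq0.
  by rewrite qN1 mulf_neq0.
apply: lim_ext (limM (@lim_cst _ 2^-1)
  (limD (euler_cvg q_lt1 (x := 1)) (euler_cvg q_lt1 (x := q)))) => n.
rewrite -big_split mulr_sumr; apply: eq_bigr => k _ /=.
have qk := qpoch_neq0 q_lt1 k q_lt1.
rewrite /euler_term mulr1 divr1 !expr1n.
case: k qk => [[|k] /= _] qk.
  by rewrite !qpoch0 bin_small // expr0; field.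
have := qN k.+1; rewrite qN1 qpochS mulNr opprK -exprS mulf_eq0 negb_or.
move=> /andP[nk nk1].
by field; rewrite qk nk.
Qed.
End TripleSums.

(** * The general case *)

Section Exponents.
Variables (R : realType) (q : R[i]).
Hypothesis q_neq0 : q != 0.

Lemma triple_term_exprz d eu ex ey i j k (z : int) :
    (z + (d * i * k)%:Z
     = (d * i ^ 2 + eu * i + (ex * j + d * i * j + d * 'C(j, 2))
        + (ey * k + d * 'C(k, 2)))%:Z)%R ->
  triple_term (q ^+ d) (q ^+ eu) (q ^+ ex) (q ^+ ey) i j k
  = q ^ z / (qpoch (q ^+ d) (q ^+ d) i * qpoch (q ^+ d) (q ^+ d) j
             * qpoch (q ^+ d) (q ^+ d) k).
Proof.
move=> zE; rewrite /triple_term /euler_term.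
have -> : q ^ z = q ^+ (d * i ^ 2 + eu * i + (ex * j + d * i * j + d * 'C(j, 2))
                        + (ey * k + d * 'C(k, 2))) / q ^+ (d * i * k).
  apply: (mulIf (expf_neq0 (d * i * k) q_neq0)); rewrite mulfVK ?expf_neq0 //.
  by rewrite !exprnP -expfzDr // zE.
rewrite (exprMn j) (exprMn k) exprVn -!exprM !exprD !invfM.
rewrite -(mulnA d i j).
by move: (q ^+ _) (q ^+ (eu * i)) => *; ring.
Qed.
End Exponents.

Lemma muln_subn1_half n : ((n * (n - 1)) %/ 2 = 'C(n, 2))%N.
Proof. by rewrite bin2 subn1 divn2. Qed.

Section ZeroBase.

(* The exponent is C(i + j, 2) + C(k - i, 2), where C(-m, 2) = C(m + 1, 2). *)
Lemma exponent1_eq0 i j k :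
  ((i ^ 2)%:Z + 'C(j, 2)%:Z + 'C(k, 2)%:Z + (i * j)%:Z - (i * k)%:Z == 0)%R
  = ((i + j <= 1) && (i <= k <= i.+1))%N.
Proof.
have bin2_eq0 n : ('C(n, 2) == 0%N) = (n <= 1)%N.
  by rewrite -leqn0 leqNgt bin_gt0 -leqNgt.
have bj := bin2_sqr j; have bk := bin2_sqr k; have bij := bin2_sqr (i + j).
have [m kE] : exists m, (k = i + m \/ i = k + m.+1)%N.
  have [ik|ki] := leqP i k; first by exists (k - i)%N; left; rewrite subnKC.
  by exists (i - k.+1)%N; right; rewrite addnS -addSn subnKC.
case: kE => kE; rewrite kE in bk bij *.
- have bm := bin2_sqr m.
  have -> : ((i ^ 2)%:Z + 'C(j, 2)%:Z + 'C(i + m, 2)%:Z + (i * j)%:Z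
      - (i * (i + m))%:Z = ('C(i + j, 2) + 'C(m, 2))%:Z)%R by lia.
  rewrite eqz_nat addn_eq0 !bin2_eq0; lia.
- have bm := bin2_sqr m.+2.
  have -> : (((k + m.+1) ^ 2)%:Z + 'C(j, 2)%:Z + 'C(k, 2)%:Z
      + ((k + m.+1) * j)%:Z - ((k + m.+1) * k)%:Z
      = ('C(k + m.+1 + j, 2) + 'C(m.+2, 2))%:Z)%R by lia.
  rewrite eqz_nat addn_eq0 !bin2_eq0; lia.
Qed.

Variable R : realType.

Lemma sum_support (V : zmodType) (G : nat -> V) K N : (K <= N)%N ->
  (forall i, (K <= i)%N -> G i = 0) -> \sum_(i < N) G i = \sum_(i < K) G i.
Proof.
move=> KN G0; rewrite -!(big_mkord xpredT G) (@big_cat_nat _ _ _ K) //=.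
rewrite [X in _ + X](_ : _ = 0) ?addr0 // big_nat.
by apply: big1 => i /andP[/G0].
Qed.

Lemma cube_sum_support (V : zmodType) (F : nat -> nat -> nat -> V) K N :
    (K <= N)%N ->
    (forall i j k, [|| K <= i, K <= j | K <= k]%N -> F i j k = 0) ->
  cube_sum F N = cube_sum F K.
Proof.
move=> KN F0; rewrite /cube_sum.
rewrite (@sum_support _ (fun i => \sum_(j < N) \sum_(k < N) F i j k) K) //.
  apply: eq_bigr => i _.
  rewrite (@sum_support _ (fun j => \sum_(k < N) F i j k) K) //.
    apply: eq_bigr => j _; apply: sum_support => // k Kk.
    by rewrite F0 ?Kk ?orbT.
  by move=> j Kj; apply: big1 => k _; rewrite F0 ?Kj ?orbT.
by move=> i Ki; apply: big1 => j _; apply: big1 => k _; rewrite F0 ?Ki.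
Qed.

Lemma qpoch00 n : qpoch (0 : R[i]) 0 n = 1.
Proof. by rewrite /qpoch big1 // => i _; rewrite mul0r subr0. Qed.

Lemma J0 m : (0 < m)%N -> J (0 : R[i]) m = 1.
Proof.
case: m => // m _; rewrite /J expr0n /=; apply: lim_eq.
by apply: lim_ext (@lim_cst _ 1) => n; rewrite qpoch00.
Qed.

Lemma cube_sum_indicator (F : nat -> nat -> nat -> R[i])
    (P : nat -> nat -> nat -> bool) :
    (forall i j k, F i j k = (P i j k)%:R) ->
    (forall i j k, P i j k -> [&& i < 3, j < 3 & k < 3]%N) ->
  cube_sum F @ \oo --> cube_sum (fun i j k => (P i j k)%:R : R[i]) 3.
Proof.
move=> FP P3; apply: (@lim_ext_near _ _ _ _ 3) (@lim_cst _ _) => N N3.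
have -> : cube_sum F N = cube_sum (fun i j k => (P i j k)%:R) N.
  by do 3!apply: eq_bigr => ? _.
symmetry; apply: cube_sum_support N3 _ => i j k.
case: (P i j k) (P3 i j k) => //.
by move=> /(_ isT) /and3P[i3 j3 k3] /or3P[]; rewrite leqNgt ?i3 ?j3 ?k3.
Qed.
End ZeroBase.

Theorem theorem4p4 (R : realType) (q : R[i]) (hq : `|q| < 1) :
  (* exponent i^2 + j^2/2 + k^2/2 + ij - ik - j/2 - k/2, written with the
     integers j(j-1)/2 and k(k-1)/2 *)
  [/\ cube_sum (fun i j k =>
        q ^ ((i ^ 2)%:Z + ((j * (j - 1)) %/ 2)%:Z + ((k * (k - 1)) %/ 2)%:Z
             + (i * j)%:Z - (i * k)%:Z)
        / (qpoch q q i * qpoch q q j * qpoch q q k)) @ \oo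
        --> 6 * (J q 2 ^+ 3 / J q 1 ^+ 3),
      cube_sum (fun i j k =>
        q ^ ((2 * i ^ 2)%:Z + (j ^ 2)%:Z + (k ^ 2)%:Z + (2 * i * j)%:Z
             - (2 * i * k)%:Z + k%:Z)
        / (qpoch (q ^+ 2) (q ^+ 2) i * qpoch (q ^+ 2) (q ^+ 2) j
           * qpoch (q ^+ 2) (q ^+ 2) k)) @ \oo
        --> J q 3 ^+ 2 * J q 4 / (J q 1 * J q 2 * J q 6),
      cube_sum (fun i j k =>
        q ^ ((2 * i ^ 2)%:Z + (j ^ 2)%:Z + (k ^ 2)%:Z + (2 * i * j)%:Z
             - (2 * i * k)%:Z + j%:Z)
        / (qpoch (q ^+ 2) (q ^+ 2) i * qpoch (q ^+ 2) (q ^+ 2) j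
           * qpoch (q ^+ 2) (q ^+ 2) k)) @ \oo
        --> J q 2 ^+ 2 * J q 3 ^+ 2 / (J q 1 ^+ 2 * J q 4 * J q 6),
      cube_sum (fun i j k =>
        q ^ ((2 * i ^ 2)%:Z + (j ^ 2)%:Z + (k ^ 2)%:Z + (2 * i * j)%:Z
             - (2 * i * k)%:Z + (2 * i)%:Z + j%:Z)
        / (qpoch (q ^+ 2) (q ^+ 2) i * qpoch (q ^+ 2) (q ^+ 2) j
           * qpoch (q ^+ 2) (q ^+ 2) k)) @ \oo
        --> J q 2 * J q 6 ^+ 2 / (J q 1 * J q 3 * J q 4) &
      cube_sum (fun i j k =>
        q ^ ((2 * i ^ 2)%:Z + (j ^ 2)%:Z + (k ^ 2)%:Z + (2 * i * j)%:Z
             - (2 * i * k)%:Z + (2 * i)%:Z + (2 * j)%:Z - k%:Z)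
        / (qpoch (q ^+ 2) (q ^+ 2) i * qpoch (q ^+ 2) (q ^+ 2) j
           * qpoch (q ^+ 2) (q ^+ 2) k)) @ \oo
        --> 2 * (J q 4 * J q 6 ^+ 2 / (J q 2 ^+ 2 * J q 3))].
Proof.
have q_lt1 : ComplexField.Normc.normc q < 1 by rewrite -ltcR -normcEC.
have [->|q_neq0] := eqVneq q 0.
  have q20 : (0 : R[i]) ^+ 2 = 0 by rewrite expr0n.
  rewrite !(@J0 R) // q20; split.
  - have -> : 6 * (1 ^+ 3 / 1 ^+ 3) = cube_sum (fun i j k =>
        (((i + j <= 1) && (i <= k <= i.+1))%N)%:R : R[i]) 3.
      by rewrite /cube_sum !big_ord_recr !big_ord0 /=; field.
    apply: cube_sum_indicator => i j k; last by lia.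
    rewrite !qpoch00 !mulr1 divr1 exp0rz; congr (nat_of_bool _)%:R.
    by rewrite !muln_subn1_half exponent1_eq0.
  - have -> : 1 ^+ 2 * 1 / (1 * 1 * 1) = cube_sum (fun i j k =>
        ([&& i == 0, j == 0 & k == 0]%N)%:R : R[i]) 3.
      by rewrite /cube_sum !big_ord_recr !big_ord0 /=; field.
    apply: cube_sum_indicator => i j k; last by lia.
    rewrite !qpoch00 !mulr1 divr1 exp0rz; congr (nat_of_bool _)%:R.
    by apply/idP/idP; nia.
  - have -> : 1 ^+ 2 * 1 ^+ 2 / (1 ^+ 2 * 1 * 1) = cube_sum (fun i j k =>
        ([&& i == 0, j == 0 & k == 0]%N)%:R : R[i]) 3.
      by rewrite /cube_sum !big_ord_recr !big_ord0 /=; field.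
    apply: cube_sum_indicator => i j k; last by lia.
    rewrite !qpoch00 !mulr1 divr1 exp0rz; congr (nat_of_bool _)%:R.
    by apply/idP/idP; nia.
  - have -> : 1 * 1 ^+ 2 / (1 * 1 * 1) = cube_sum (fun i j k =>
        ([&& i == 0, j == 0 & k == 0]%N)%:R : R[i]) 3.
      by rewrite /cube_sum !big_ord_recr !big_ord0 /=; field.
    apply: cube_sum_indicator => i j k; last by lia.
    rewrite !qpoch00 !mulr1 divr1 exp0rz; congr (nat_of_bool _)%:R.
    by apply/idP/idP; nia.
  - have -> : 2 * (1 * 1 ^+ 2 / (1 ^+ 2 * 1)) = cube_sum (fun i j k =>
        ([&& i == 0, j == 0 & k <= 1]%N)%:R : R[i]) 3.
      by rewrite /cube_sum !big_ord_recr !big_ord0 /=; field.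
    apply: cube_sum_indicator => i j k; last by lia.
    rewrite !qpoch00 !mulr1 divr1 exp0rz; congr (nat_of_bool _)%:R.
    by apply/idP/idP; nia.
have E := triple_term_exprz q_neq0.
split.
- apply: lim_ext (triple_sum1 q_neq0 q_lt1) => N.
  apply: eq_bigr => i _; apply: eq_bigr => j _; apply: eq_bigr => k _.
  apply: (E 1 0 0 0)%N; rewrite !muln_subn1_half; lia.
- apply: lim_ext (triple_sum2 q_neq0 q_lt1) => N.
  apply: eq_bigr => i _; apply: eq_bigr => j _; apply: eq_bigr => k _.
  apply: (E 2 0 1 2)%N; have := bin2_sqr j; have := bin2_sqr k; nia.
- apply: lim_ext (triple_sum3 q_neq0 q_lt1) => N.
  apply: eq_bigr => i _; apply: eq_bigr => j _; apply: eq_bigr => k _.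
  apply: (E 2 0 2 1)%N; have := bin2_sqr j; have := bin2_sqr k; nia.
- apply: lim_ext (triple_sum4 q_neq0 q_lt1) => N.
  apply: eq_bigr => i _; apply: eq_bigr => j _; apply: eq_bigr => k _.
  apply: (E 2 2 2 1)%N; have := bin2_sqr j; have := bin2_sqr k; nia.
- apply: lim_ext (triple_sum5 q_neq0 q_lt1) => N.
  apply: eq_bigr => i _; apply: eq_bigr => j _; apply: eq_bigr => k _.
  apply: (E 2 2 3 0)%N; have := bin2_sqr j; have := bin2_sqr k; nia.
Qed.
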